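(* There is an algorithm running in time $2^{2^{\mathrm{poly}(n)}}$ ($n$ the bit length of the input; i.e. a $\mathsf{2\text{-}EXPTIME}$ algorithm) which decides, given any $x, y \in \mathbb{Z}$ and any finite set $F$ of functions $f_i(z) = a_i z + b_i$ with $a_i, b_i \in \mathbb{Z}$, whether $x \xrightarrow{F} y$. In particular, affine reachability over $\mathbb{Z}$ (in dimension one) is decidable.
   Context: For a set $S$ of affine functions $\mathbb{Z}\to\mathbb{Z}$, an $S$-composition is a finite tuple $(s_1,\dots,s_K)$ with $K \ge 0$ and each $s_i \in S$, identified with the function $s_K \circ \dots \circ s_1$ (the empty tuple being the identity). We write $x \xrightarrow{S} y$ if there exists an $S$-composition $G$ with $G(x) = y$. *)

(* Defs.v *)
From Stdlib Require Import ZArith List Arith.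
Import ListNotations.
Open Scope Z_scope.

Definition aff_apply (s : Z * Z) (z : Z) : Z := fst s * z + snd s.

Definition compose_apply (l : list (Z * Z)) (x : Z) : Z :=
  fold_left (fun z s => aff_apply s z) l x.

Definition reach (F : list (Z * Z)) (x y : Z) : Prop :=
  exists l : list (Z * Z), (forall s, In s l -> In s F) /\ compose_apply l x = y.

(* Tape symbols are naturals < nsyms, 0 is the blank; states are naturals < nstates. *)
Inductive move := MoveL | MoveR | Stay.

Record TM := mkTM {
  nstates : nat;
  nsyms : nat;
  delta : nat -> nat -> nat * nat * move;  (* state, read symbol -> new state, written symbol, move *)
  q0 : nat;
  qacc : nat;
  qrej : nat
}.

(* Well-formedness: finite control, finite alphabet containing the input symbols 1..4. *)
Definition TM_wf (M : TM) : Prop :=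
  (q0 M < nstates M)%nat /\ (qacc M < nstates M)%nat /\ (qrej M < nstates M)%nat /\
  qacc M <> qrej M /\ (5 <= nsyms M)%nat /\
  forall q s, (q < nstates M)%nat -> (s < nsyms M)%nat ->
    match delta M q s with (q', w, _) => (q' < nstates M)%nat /\ (w < nsyms M)%nat end.

(* Configuration: state, cells to the left (nearest first), current cell, cells to the right. *)
Record config := mkConfig {
  cst : nat;
  cleft : list nat;
  ccur : nat;
  cright : list nat
}.

Definition halted (M : TM) (c : config) : Prop := cst c = qacc M \/ cst c = qrej M.

Definition step (M : TM) (c : config) : config :=
  if (Nat.eqb (cst c) (qacc M) || Nat.eqb (cst c) (qrej M))%bool then c else
  match delta M (cst c) (ccur c) with
  | (q', w, MoveL) =>
      match cleft c with
      | [] => mkConfig q' [] 0%nat (w :: cright c)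
      | a :: l => mkConfig q' l a (w :: cright c)
      end
  | (q', w, MoveR) =>
      match cright c with
      | [] => mkConfig q' (w :: cleft c) 0%nat []
      | a :: r => mkConfig q' (w :: cleft c) a r
      end
  | (q', w, Stay) => mkConfig q' (cleft c) w (cright c)
  end.

Definition init (M : TM) (input : list nat) : config :=
  match input with
  | [] => mkConfig (q0 M) [] 0%nat []
  | a :: r => mkConfig (q0 M) [] a r
  end.

Definition run (M : TM) (t : nat) (input : list nat) : config :=
  Nat.iter t (step M) (init M input).

(* symbols: 1 = bit 0, 2 = bit 1, 3 = end of number, 4 = minus sign;
   binary digits are little-endian. *)
Fixpoint pos_bits (p : positive) : list nat :=
  match p with
  | xH => [2%nat]
  | xO p' => 1%nat :: pos_bits p'
  | xI p' => 2%nat :: pos_bits p'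
  end.

Definition enc_Z (z : Z) : list nat :=
  match z with
  | Z0 => [3%nat]
  | Zpos p => pos_bits p ++ [3%nat]
  | Zneg p => 4%nat :: pos_bits p ++ [3%nat]
  end.

Definition enc_input (x y : Z) (F : list (Z * Z)) : list nat :=
  enc_Z x ++ enc_Z y ++ flat_map (fun s => enc_Z (fst s) ++ enc_Z (snd s)) F.

(* Main.v *)
(* If y is reachable from x, then some path stays within [-B, B], where B is doubly exponential in
   the input length. Only the part of a path after its last constant function matters. If there are
   translations in both directions (possibly obtained by composing reflections), only residues
   modulo a fixed shift m matter: remove the loops from the path modulo m, then translate. If all
   translations go up by nonnegative amounts, one of them by g > 0, and there are no reflections,
   then a path that has left a large interval can return only from below by a translation; such an
   excursion can be replaced by a loop-free word in the finite graph of pairs (residue modulo g,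
   sign), followed by translations by g. With no translation and at most one reflection, large
   values never decrease.

   A path within [-B, B] may be taken without repetitions, so it suffices to saturate a bitmap of
   [-L, L], for a suitable doubly exponential L, in L rounds. This is a program with bounded loops
   on registers that never exceed L; its registers are represented by marks on the cells of the
   tape. Its running time on the machine is polynomial in L, since loop counts and head positions
   are at most L. *)

Require Import Defs.
From Stdlib Require Import ZArith List Arith Lia Bool FunctionalExtensionality.
Import ListNotations.
Open Scope Z_scope.

(** * Bounded paths *)

(** The bounds are applied with M = 2^n, where n is the input length. A step multiplies |z| + 1 by
    at most M + 1, so a word of k letters from [-M, M] stays below (M + 1)^(k + 1), and everything
    hinges on making words short. Removing loops modulo m leaves fewer than m letters, and m can be
    as large as M^2: this is where the double exponential comes from. The delicate case is that of
    upward translations only. A gap can then be closed upwards but not downwards, so the right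
    residue is not enough: the shortened excursion must also end below the original one. Outside
    [-M, M] the sign of the value depends only on the initial sign and the slopes, which is why it
    is recorded with the residue; starting far enough out keeps the shortened excursion outside
    [-M, M]. On the machine side, the program does not compute the bound B. It builds the limit by
    repeated doubling, to slightly more than 2^(2^(10 n)). Later arithmetic is truncated at the
    limit, and a register that has reached it is treated as an overflow. *)

Fixpoint along {A L : Type} (T : A -> L -> A) (P : A -> Prop) (a : A) (l : list L) : Prop :=
  P a /\ match l with [] => True | s :: l' => along T P (T a s) l' end.

Lemma along_impl {A L : Type} (T : A -> L -> A) (P Q : A -> Prop) :
  (forall a, P a -> Q a) -> forall l a, along T P a l -> along T Q a l.
Proof.
  intros HPQ; induction l as [|s l IH]; intros a [H1 H2]; split; auto.
Qed.

Lemma along_invariant {A L : Type} (T : A -> L -> A) (P : A -> Prop) :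
  (forall a s, P a -> P (T a s)) -> forall l a, P a -> along T P a l.
Proof.
  intros HP; induction l as [|s l IH]; intros a Ha; split; auto.
Qed.

(** Cutting a path at its last visit to [a] leaves a path that starts at [a] and never comes back,
    so [a] can be deleted from the available points. *)
Lemma last_visit {A L : Type} (T : A -> L -> A) (dec : forall a b : A, {a = b} + {a <> b})
  (P : A -> Prop) (a : A) : forall l b, along T P b l ->
  along T (fun c => P c /\ c <> a) b l \/
  exists l2, incl l2 l /\ fold_left T l2 a = fold_left T l b /\
    match l2 with
    | [] => True
    | s :: l3 => along T (fun c => P c /\ c <> a) (T a s) l3
    end.
Proof.
  induction l as [|s l IH]; intros b [Hb Hl].
  - destruct (dec b a) as [->|Hne].
    + right; exists []; repeat split; auto using incl_refl.
    + left; repeat split; auto.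
  - destruct (IH _ Hl) as [Hav|(l2 & Hi & Hf & Hm)].
    + destruct (dec b a) as [->|Hne].
      * right; exists (s :: l); repeat split; auto using incl_refl.
      * left; repeat split; auto.
    + right; exists l2; repeat split; auto using incl_tl.
Qed.

(** Strong induction on the number of available points: after the last visit to the starting point
    the rest of the path lives in [remove dec a U]. Only letters of the given word are used, so
    membership in the set of functions is kept. *)
Lemma loop_removal {A L : Type} (T : A -> L -> A) (dec : forall a b : A, {a = b} + {a <> b}) :
  forall (U : list A) l a, along T (fun c => In c U) a l ->
  exists l', incl l' l /\ (length l' < length U)%nat /\
    fold_left T l' a = fold_left T l a /\ along T (fun c => In c U) a l'.
Proof.
  intros U; remember (length U) as n eqn:Hn; revert U Hn.
  induction n as [n IHn] using lt_wf_ind; intros U Hn l a Hal.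
  assert (Ha : In a U) by (destruct l; apply Hal).
  destruct (last_visit T dec _ a l a Hal) as [Hc|(l2 & Hi & Hf & Hm)].
  { destruct l; destruct Hc as [[_ Hc] _]; congruence. }
  destruct l2 as [|s l3].
  - exists []; repeat split; auto using incl_nil_l.
    destruct U; [destruct Ha|simpl in *; lia].
  - pose proof (remove_length_lt dec U a Ha) as Hlt.
    destruct (IHn (length (remove dec a U)) ltac:(lia) _ eq_refl l3 (T a s)) as (l' & H1 & H2 & H3 & H4).
    { revert Hm; apply along_impl; intros c [Hc1 Hc2]; apply in_in_remove; auto. }
    exists (s :: l'); repeat split.
    + intros t [<-|Ht]; apply Hi; [left|right]; auto.
    + simpl; lia.
    + simpl; rewrite H3; exact Hf.
    + exact Ha.
    + revert H4; apply along_impl; intros c Hc; apply in_remove in Hc; tauto.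
Qed.

(** * Reachability inside an interval *)

Inductive breach (F : list (Z * Z)) (B : Z) : Z -> Z -> Prop :=
| breach_refl u : Z.abs u <= B -> breach F B u u
| breach_step u s v : Z.abs u <= B -> In s F -> breach F B (aff_apply s u) v -> breach F B u v.

Lemma breach_trans F B u v w : breach F B u v -> breach F B v w -> breach F B u w.
Proof. induction 1; intros; auto; econstructor; eauto. Qed.

Lemma breach_mono F G B C u v : incl F G -> B <= C -> breach F B u v -> breach G C u v.
Proof. intros HF HB; induction 1; [constructor|econstructor]; eauto; lia. Qed.

Lemma breach_bound_l F B u v : breach F B u v -> Z.abs u <= B.
Proof. destruct 1; auto. Qed.

Lemma breach_bound_r F B u v : breach F B u v -> Z.abs v <= B.
Proof. induction 1; auto. Qed.

(** Conjugation by z -> -z. It keeps slopes and reverses translations, which reduces the case of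
    downward translations to that of upward ones. *)
Definition negate (s : Z * Z) : Z * Z := (fst s, - snd s).

Lemma negate_apply s z : aff_apply (negate s) (- z) = - aff_apply s z.
Proof. unfold aff_apply, negate; simpl; ring. Qed.

Lemma negate_involutive s : negate (negate s) = s.
Proof. destruct s; unfold negate; simpl; f_equal; lia. Qed.

Lemma breach_negate F B u v : breach F B u v -> breach (map negate F) B (- u) (- v).
Proof.
  induction 1.
  - apply breach_refl; lia.
  - apply breach_step with (s := negate s); [lia|now apply in_map|].
    now rewrite negate_apply.
Qed.

Lemma breach_negate_inv F B u v : breach (map negate F) B (- u) (- v) -> breach F B u v.
Proof.
  intros H; apply breach_negate in H; rewrite !Z.opp_involutive in H.
  eapply breach_mono; [|apply Z.le_refl|exact H].
  intros s Hs; rewrite map_map in Hs; apply in_map_iff in Hs; destruct Hs as (t & <- & Ht).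
  now rewrite negate_involutive.
Qed.

Lemma compose_negate l : forall x,
  compose_apply (map negate l) (- x) = - compose_apply l x.
Proof.
  induction l as [|s l IH]; intros x; [reflexivity|].
  unfold compose_apply in *; simpl; rewrite negate_apply; apply IH.
Qed.

Definition bounded_coeffs (M : Z) (F : list (Z * Z)) : Prop :=
  forall s, In s F -> Z.abs (fst s) <= M /\ Z.abs (snd s) <= M.

(** Working with |z| + 1 makes growth purely multiplicative, so a word of length k costs a factor (M
    + 1)^k. *)
Lemma aff_growth M s z : Z.abs (fst s) <= M -> Z.abs (snd s) <= M ->
  Z.abs (aff_apply s z) + 1 <= (M + 1) * (Z.abs z + 1).
Proof. unfold aff_apply; intros; nia. Qed.

Lemma breach_word M F B : 0 <= M -> bounded_coeffs M F -> forall l z, incl l F ->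
  (M + 1) ^ Z.of_nat (length l) * (Z.abs z + 1) <= B ->
  breach F B z (compose_apply l z).
Proof.
  intros HM HF; induction l as [|s l IH]; intros z Hl HB.
  - change (breach F B z z); apply breach_refl; simpl length in HB; rewrite Z.pow_0_r in HB; lia.
  - assert (Hs : In s F) by (apply Hl; left; auto).
    destruct (HF s Hs) as [H1 H2].
    pose proof (aff_growth M s z H1 H2) as Hg.
    simpl length in HB; rewrite Nat2Z.inj_succ, Z.pow_succ_r in HB by lia.
    pose proof (Z.pow_pos_nonneg (M + 1) (Z.of_nat (length l)) ltac:(lia) ltac:(lia)) as Hp.
    apply breach_step with (s := s); auto.
    + nia.
    + apply IH; [intros t Ht; apply Hl; right; auto|nia].
Qed.

Lemma breach_translate F b : In (1, b) F -> forall (k : nat) z,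
  breach F (Z.abs z + Z.of_nat k * Z.abs b) z (z + Z.of_nat k * b).
Proof.
  intros Hb; induction k as [|k IH]; intros z.
  - rewrite !Z.mul_0_l, !Z.add_0_r; apply breach_refl; lia.
  - apply breach_step with (s := (1, b)); [lia|auto|].
    replace (z + Z.of_nat (S k) * b) with (aff_apply (1, b) z + Z.of_nat k * b)
      by (unfold aff_apply; simpl fst; simpl snd; lia).
    eapply breach_mono; [apply incl_refl| |apply IH].
    unfold aff_apply; simpl fst; simpl snd. nia.
Qed.

Lemma compose_app l1 l2 z : compose_apply (l1 ++ l2) z = compose_apply l2 (compose_apply l1 z).
Proof. apply fold_left_app. Qed.

(** * Residues, and translations in both directions *)

Definition step_mod (m : Z) (r : Z) (s : Z * Z) : Z := aff_apply s r mod m.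

Lemma aff_mod m s z : m <> 0 -> aff_apply s (z mod m) mod m = aff_apply s z mod m.
Proof.
  intros Hm; unfold aff_apply.
  rewrite Z.add_mod, Z.mul_mod_idemp_r, <- Z.add_mod; auto.
Qed.

Lemma fold_step_mod m l : m <> 0 -> forall z,
  fold_left (step_mod m) l (z mod m) = compose_apply l z mod m.
Proof.
  intros Hm; induction l as [|s l IH]; intros z; [reflexivity|].
  simpl; unfold step_mod at 2; rewrite aff_mod by auto.
  apply IH.
Qed.

Definition residues (m : Z) : list Z := map Z.of_nat (seq 0 (Z.to_nat m)).

Lemma in_residues m z : 0 < m -> In (z mod m) (residues m).
Proof.
  intros Hm; pose proof (Z.mod_pos_bound z m Hm).
  apply in_map_iff; exists (Z.to_nat (z mod m)); split; [lia|].
  apply in_seq; lia.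
Qed.

Lemma length_residues m : length (residues m) = Z.to_nat m.
Proof. unfold residues; now rewrite length_map, length_seq. Qed.

Lemma congruent_shift m u v : 0 < m -> u mod m = v mod m -> exists k, v = u + k * m.
Proof.
  intros Hm He; exists (v / m - u / m).
  pose proof (Z.div_mod u m ltac:(lia)); pose proof (Z.div_mod v m ltac:(lia)).
  rewrite He in *. lia.
Qed.

(* The quantity |2z - c| is invariant under z -> -z + c and, once large, grows under every
   expanding map. *)
Lemma breach_no_translation M F c : 1 <= M -> bounded_coeffs M F -> Z.abs c <= M ->
  (forall s, In s F -> 2 <= Z.abs (fst s) \/ s = (1, 0) \/ s = (-1, c)) ->
  forall l x, incl l F -> Z.abs (compose_apply l x) <= M ->
  breach F (M * M + 4 * M) x (compose_apply l x).
Proof.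
  intros HM HF Hc HU.
  (* The threshold M^2 + 3M bounds the error |a c + 2 b - c|: beyond it, doubling |2u - c| gains
     more than the error can take away. *)
  assert (Hinv : forall l u, incl l F -> M * M + 3 * M < Z.abs (2 * u - c) ->
    M * M + 3 * M < Z.abs (2 * compose_apply l u - c)).
  { induction l as [|s l IH]; intros u Hl Hu; [exact Hu|].
    apply (IH (aff_apply s u)); [intros t Ht; apply Hl; right; auto|].
    assert (Hs : In s F) by (apply Hl; left; auto).
    destruct (HF s Hs) as [H1 H2].
    destruct (HU s Hs) as [H|[-> | ->]]; unfold aff_apply; simpl fst; simpl snd.
    - replace (2 * (fst s * u + snd s) - c)
        with (fst s * (2 * u - c) + (fst s * c + 2 * snd s - c)) by ring.
      assert (Z.abs (fst s * c) <= M * M) by nia.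
      assert (2 * Z.abs (2 * u - c) <= Z.abs (fst s * (2 * u - c))) by nia.
      lia.
    - lia.
    - lia. }
  assert (Hsmall : forall u l, incl l F -> Z.abs (compose_apply l u) <= M ->
    Z.abs u <= M * M + 4 * M).
  { intros u l Hl Hy.
    destruct (Z_lt_le_dec (M * M + 3 * M) (Z.abs (2 * u - c))) as [H|H]; [|nia].
    apply (Hinv l u Hl) in H; nia. }
  induction l as [|s l IH]; intros x Hl Hy.
  - apply breach_refl; eapply Hsmall; eauto.
  - apply breach_step with (s := s).
    + eapply Hsmall; eauto.
    + apply Hl; left; auto.
    + apply IH; auto. intros t Ht; apply Hl; right; auto.
Qed.

(** [E] is the extra room used by the words that realise a shift by m. The loop-free word has fewer
    than m letters, so its end point v satisfies |v| <= (M + 1)^(m + 1). The correction from v to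
    the target is at most |v| + M in size, which gives the total 2|v| + M + E. *)
Lemma breach_two_way M F m E : 1 <= M -> bounded_coeffs M F -> 0 < m -> 0 <= E ->
  (forall z, breach F (Z.abs z + E) z (z + m)) ->
  (forall z, breach F (Z.abs z + E) z (z - m)) ->
  forall l x, incl l F -> Z.abs x <= M -> Z.abs (compose_apply l x) <= M ->
  breach F (2 * (M + 1) ^ (m + 1) + M + E) x (compose_apply l x).
Proof.
  intros HM HF Hm HE Hup Hdown l x Hl Hx Hy.
  assert (Hshift : forall k : nat, forall z,
    breach F (Z.abs z + Z.of_nat k * m + E) z (z + Z.of_nat k * m) /\
    breach F (Z.abs z + Z.of_nat k * m + E) z (z - Z.of_nat k * m)).
  { induction k as [|k IH]; intros z.
    - rewrite !Z.mul_0_l, !Z.add_0_r, Z.sub_0_r; split; apply breach_refl; lia.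
    - split.
      + eapply breach_trans; [eapply breach_mono; [apply incl_refl| |apply Hup]; lia|].
        replace (z + Z.of_nat (S k) * m) with (z + m + Z.of_nat k * m) by lia.
        eapply breach_mono; [apply incl_refl| |apply IH]; lia.
      + eapply breach_trans; [eapply breach_mono; [apply incl_refl| |apply Hdown]; lia|].
        replace (z - Z.of_nat (S k) * m) with (z - m - Z.of_nat k * m) by lia.
        eapply breach_mono; [apply incl_refl| |apply IH]; lia. }
  destruct (loop_removal (step_mod m) Z.eq_dec (residues m) l (x mod m))
    as (l' & Hi & Hlen & Hf & _).
  { apply along_invariant; [intros; apply in_residues; auto|apply in_residues; auto]. }
  rewrite length_residues in Hlen.
  rewrite !fold_step_mod in Hf by lia.
  set (v := compose_apply l' x) in *; set (y := compose_apply l x) in *.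
  pose proof (Z.pow_le_mono_r (M + 1) (Z.of_nat (length l')) m ltac:(lia) ltac:(lia)) as Hp.
  assert (Hw : breach F ((M + 1) ^ (m + 1)) x v).
  { apply (breach_word M); auto; [lia|eapply incl_tran; eauto|].
    rewrite Z.pow_add_r, Z.pow_1_r by lia.
    pose proof (Z.pow_pos_nonneg (M + 1) (Z.of_nat (length l')) ltac:(lia) ltac:(lia)).
    nia. }
  pose proof (breach_bound_r _ _ _ _ Hw) as Hv.
  eapply breach_trans; [eapply breach_mono; [apply incl_refl| |apply Hw]; lia|].
  destruct (congruent_shift m v y Hm Hf) as [k Hk].
  destruct (Hshift (Z.to_nat (Z.abs k)) v) as [Hs1 Hs2].
  assert (Z.abs (k * m) <= Z.abs y + Z.abs v) by lia.
  rewrite Z.abs_mul, (Z.abs_eq m) in * by lia.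
  rewrite Z2Nat.id in * by lia.
  destruct (Z_le_gt_dec 0 k).
  - replace y with (v + Z.abs k * m) by (rewrite Z.abs_eq; lia).
    eapply breach_mono; [apply incl_refl| |apply Hs1]; lia.
  - replace y with (v - Z.abs k * m) by (rewrite Z.abs_neq; lia).
    eapply breach_mono; [apply incl_refl| |apply Hs2]; lia.
Qed.

(** * Upward translations only: shortening excursions *)

Definition residue_sign (g z : Z) : Z * bool := (z mod g, z <? 0).

Definition step_residue_sign (g : Z) (p : Z * bool) (s : Z * Z) : Z * bool :=
  (step_mod g (fst p) s, xorb (snd p) (fst s <? 0)).

Definition apply_to (z : Z) (s : Z * Z) : Z := aff_apply s z.

(** For |z| > M and a <> 0 one has |a z| > M >= |b|, so a z + b has the sign of a z. Along such
    points the finite graph follows the actual values. *)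
Lemma fold_residue_sign M F g : bounded_coeffs M F -> (forall s, In s F -> fst s <> 0) -> 0 < g ->
  forall l z, incl l F -> along apply_to (fun c => M < Z.abs c) z l ->
  fold_left (step_residue_sign g) l (residue_sign g z) = residue_sign g (compose_apply l z).
Proof.
  intros HF Hnc Hg; induction l as [|s l IH]; intros z Hl Hal; [reflexivity|].
  destruct Hal as [Hz Hal].
  assert (Hs : In s F) by (apply Hl; left; auto).
  destruct (HF s Hs) as [H1 H2]; specialize (Hnc s Hs).
  simpl fold_left.
  replace (step_residue_sign g (residue_sign g z) s) with (residue_sign g (aff_apply s z)).
  - apply IH; auto. intros t Ht; apply Hl; right; auto.
  - unfold step_residue_sign, residue_sign, step_mod; simpl fst; simpl snd.
    rewrite aff_mod by lia; f_equal.
    unfold aff_apply.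
    assert (Z.abs z <= Z.abs (fst s * z)) by nia.
    destruct (Z.ltb_spec z 0), (Z.ltb_spec (fst s) 0); simpl.
    + apply Z.ltb_ge; nia.
    + apply Z.ltb_lt; nia.
    + apply Z.ltb_lt; nia.
    + apply Z.ltb_ge; nia.
Qed.

(** With nonzero slope, |a z + b| >= |z| - M: one letter loses at most M, so a short word that
    starts far out stays far out. *)
Lemma slow_decrease M F : 0 <= M -> bounded_coeffs M F -> (forall s, In s F -> fst s <> 0) ->
  forall l z, incl l F -> M + Z.of_nat (length l) * M < Z.abs z ->
  along apply_to (fun c => M < Z.abs c) z l /\
  Z.abs z - Z.of_nat (length l) * M <= Z.abs (compose_apply l z).
Proof.
  intros HM HF Hnc; induction l as [|s l IH]; intros z Hl Hz.
  - simpl in *; split; [split; [lia|auto]|lia].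
  - assert (Hs : In s F) by (apply Hl; left; auto).
    destruct (HF s Hs) as [H1 H2]; specialize (Hnc s Hs).
    assert (Z.abs z - M <= Z.abs (aff_apply s z)).
    { unfold aff_apply. assert (Z.abs z <= Z.abs (fst s * z)) by nia. lia. }
    simpl length in *; rewrite Nat2Z.inj_succ in *.
    destruct (IH (aff_apply s z)) as [I1 I2].
    { intros t Ht; apply Hl; right; auto. }
    { lia. }
    split; [split; [lia|exact I1]|].
    change (compose_apply (s :: l) z) with (compose_apply l (aff_apply s z)); lia.
Qed.

(** If |a| >= 2 and |z| > M, then |a z + b| >= 2|z| - M > M. So only a translation can bring the
    value back to [-M, M], and as it goes upwards, the value before it lies below -M. *)
Lemma excursion_end M F : 0 <= M -> bounded_coeffs M F ->
  (forall s, In s F -> 2 <= Z.abs (fst s) \/ fst s = 1 /\ 0 <= snd s) ->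
  forall l z, incl l F -> M < Z.abs z -> Z.abs (compose_apply l z) <= M ->
  exists l1 b l2, l = l1 ++ (1, b) :: l2 /\ 0 <= b /\
    along apply_to (fun c => M < Z.abs c) z l1 /\
    compose_apply l1 z < - M /\ Z.abs (compose_apply l1 z + b) <= M.
Proof.
  intros HM HF HU; induction l as [|s l IH]; intros z Hl Hz Hy.
  - unfold compose_apply in Hy; simpl in Hy; lia.
  - assert (Hs : In s F) by (apply Hl; left; auto).
    destruct (HF s Hs) as [H1 H2].
    destruct (Z_lt_le_dec M (Z.abs (aff_apply s z))) as [H|H].
    + destruct (IH (aff_apply s z)) as (l1 & b & l2 & -> & Hb & Hal & He & Hw); auto.
      { intros t Ht; apply Hl; right; auto. }
      exists (s :: l1), b, l2; repeat split; auto.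
    + unfold aff_apply in H.
      destruct (HU s Hs) as [Ha|[Ha Hb]].
      { assert (2 * Z.abs z <= Z.abs (fst s * z)) by nia. lia. }
      destruct s as [a b]; simpl in *; subst a.
      exists [], b, l; unfold compose_apply; simpl fold_left; repeat split; auto; try lia.
Qed.

Lemma breach_one_way M F g : 1 <= M -> bounded_coeffs M F ->
  (forall s, In s F -> 2 <= Z.abs (fst s) \/ fst s = 1 /\ 0 <= snd s) ->
  In (1, g) F -> 0 < g ->
  forall l x, incl l F -> Z.abs x <= M -> Z.abs (compose_apply l x) <= M ->
  breach F ((M + 1) ^ (2 * M + 4)) x (compose_apply l x).
Proof.
  intros HM HF HU Hg Hg0.
  assert (HgM : g <= M) by (destruct (HF _ Hg); simpl in *; lia).
  assert (Hnc : forall s, In s F -> fst s <> 0)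
    by (intros s Hs; destruct (HU s Hs); lia).
  (* A shortened excursion has fewer than 2g <= 2M letters and loses at most M per letter; started
     beyond K, it ends beyond 2M in absolute value. *)
  set (K := 2 * M * M + 2 * M).
  (* This is the bound for a word of at most 2M letters from a point z one step away from [-K, K],
     where |z| + 1 <= (M + 1)(K + 1) <= (M + 1)^4. *)
  assert (HK : (M + 1) ^ (2 * M) * ((M + 1) * (K + 1)) <= (M + 1) ^ (2 * M + 4)).
  { rewrite (Z.pow_add_r _ (2 * M) 4) by lia.
    pose proof (Z.pow_pos_nonneg (M + 1) (2 * M) ltac:(lia) ltac:(lia)).
    apply Z.mul_le_mono_nonneg_l; [lia|]. unfold K. nia. }
  set (B := (M + 1) ^ (2 * M + 4)) in *.
  assert (HKB : (M + 1) * (K + 1) <= B).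
  { pose proof (Z.pow_pos_nonneg (M + 1) (2 * M) ltac:(lia) ltac:(lia)). nia. }
  (* The induction covers all starting points in [-K, K]: steps inside this interval are kept, and
     only a step out of it triggers a replacement. After the return to [-M, M] the remaining word is
     shorter. *)
  assert (Hmain : forall n l u, (length l <= n)%nat -> incl l F -> Z.abs u <= K ->
    Z.abs (compose_apply l u) <= M -> breach F B u (compose_apply l u)).
  { induction n as [|n IH]; intros l u Hn Hl Hu Hy.
    { destruct l; [|simpl in Hn; lia]. apply breach_refl; nia. }
    destruct l as [|s l]; [apply breach_refl; nia|].
    assert (Hs : In s F) by (apply Hl; left; auto).
    assert (Hl' : incl l F) by (intros t Ht; apply Hl; right; auto).
    simpl in Hn.
    destruct (HF s Hs) as [H1 H2].
    pose proof (aff_growth M s u H1 H2) as Hgr.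
    change (compose_apply (s :: l) u) with (compose_apply l (aff_apply s u)) in *.
    apply breach_step with (s := s); [nia|auto|].
    set (z := aff_apply s u) in *.
    destruct (Z_le_gt_dec (Z.abs z) K) as [Hz|Hz].
    { apply IH; auto; lia. }
    destruct (excursion_end M F ltac:(lia) HF HU l z Hl' ltac:(nia) Hy)
      as (l1 & b & l2 & -> & Hb & Hal & He & Hw).
    assert (Hl1 : incl l1 F) by (intros t Ht; apply Hl'; apply in_or_app; auto).
    assert (Hl2 : incl l2 F) by (intros t Ht; apply Hl'; apply in_or_app; right; right; auto).
    assert (Hb1 : In (1, b) F) by (apply Hl'; apply in_or_app; right; left; auto).
    assert (HbM : b <= M) by (destruct (HF _ Hb1); simpl in *; lia).
    rewrite compose_app in *.
    set (e := compose_apply l1 z) in *.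
    change (compose_apply ((1, b) :: l2) e) with (compose_apply l2 (aff_apply (1, b) e)) in *.
    replace (aff_apply (1, b) e) with (e + b) in * by (unfold aff_apply; simpl fst; simpl snd; lia).
    set (U := list_prod (residues g) [true; false]).
    assert (HU' : forall p : Z * bool, In (fst p) (residues g) -> In p U).
    { intros [r t] Hr; apply in_prod; auto. destruct t; simpl; auto. }
    destruct (loop_removal (step_residue_sign g)
      (fun p q => ltac:(decide equality; [apply Bool.bool_dec|apply Z.eq_dec]))
      U l1 (residue_sign g z)) as (l' & Hi & Hlen & Hf & _).
    { apply along_invariant.
      - intros p t _; apply HU'; simpl; apply in_residues; auto.
      - apply HU'; simpl; apply in_residues; auto. }
    unfold U in Hlen; rewrite length_prod, length_residues in Hlen; simpl in Hlen.
    assert (Hi' : incl l' F) by (eapply incl_tran; eauto).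
    assert (HlenM : Z.of_nat (length l') * M <= 2 * M * M) by nia.
    (* The shortened word also stays outside [-M, M], so the graph computes the residue and sign of
       its actual end point. *)
    destruct (slow_decrease M F ltac:(lia) HF Hnc l' z Hi' ltac:(unfold K in *; lia)) as [Hal' Hdec].
    rewrite !(fold_residue_sign M F g HF Hnc Hg0) in Hf by auto.
    fold e in Hf.
    assert (Hword : breach F B z (compose_apply l' z)).
    { apply (breach_word M); auto; [lia|].
      eapply Z.le_trans; [|exact HK].
      apply Z.mul_le_mono_nonneg; [apply Z.pow_nonneg; lia| |lia|].
      - apply Z.pow_le_mono_r; lia.
      - eapply Z.le_trans; [exact Hgr|]; apply Z.mul_le_mono_nonneg_l; lia. }
    set (e' := compose_apply l' z) in *.
    unfold residue_sign in Hf; injection Hf as Hmod Hsgn.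
    assert (Hneg : e' < 0).
    { apply Z.ltb_lt; rewrite Hsgn; apply Z.ltb_lt; lia. }
    pose proof (breach_bound_r _ _ _ _ Hword) as He'.
    eapply breach_trans; [exact Hword|].
    apply breach_step with (s := (1, b)); auto.
    replace (aff_apply (1, b) e') with (e' + b) by (unfold aff_apply; simpl fst; simpl snd; lia).
    destruct (congruent_shift g e' e Hg0 Hmod) as [k Hk].
    (* Since e >= -M - b >= -2M > e', the gap from e' to e is a nonnegative multiple of g, so it can
       be climbed by translations by g. *)
    assert (Hlow : e' < - 2 * M) by (clear - Hneg Hdec Hz HlenM; unfold K in *; lia).
    assert (Hk0 : 0 <= k) by (clear - Hk Hlow Hw Hg0 HbM He; nia).
    apply breach_trans with (v := e + b).
    - assert (Hlin : forall (j : nat) v, v + Z.of_nat j * g <= M -> -B <= v -> M <= B ->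
         breach F B v (v + Z.of_nat j * g)).
      { induction j as [|j IHj]; intros v Hv1 Hv2 Hv3.
        - rewrite !Z.mul_0_l, !Z.add_0_r; apply breach_refl; lia.
        - apply breach_step with (s := (1, g)); [lia|auto|].
          replace (v + Z.of_nat (S j) * g) with (v + g + Z.of_nat j * g) by lia.
          replace (aff_apply (1, g) v) with (v + g) by (unfold aff_apply; simpl fst; simpl snd; lia).
          apply IHj; lia. }
      specialize (Hlin (Z.to_nat k) (e' + b)).
      rewrite Z2Nat.id in Hlin by lia.
      replace (e' + b + k * g) with (e + b) in Hlin by lia.
      apply Hlin; lia.
    - apply IH; auto.
      + rewrite length_app in Hn; simpl in Hn; clear - Hn; lia.
      + assert (M <= K) by (clear - HM; unfold K; nia); lia. }
  intros l x Hl Hx Hy; apply (Hmain (length l)); auto.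
  assert (M <= K) by (clear - HM; unfold K; nia); lia.
Qed.

(** One bound for all cases. The shift m is at most M^2 for opposite translations, M for a
    translation with a reflection, and 2M for two reflections; the one-way case needs the exponent
    2M + 4. The spare powers of M + 1 absorb the factor 2 and the additive terms. *)
Definition value_bound (M : Z) : Z := (M + 1) ^ (M * M + 2 * M + 4).

Lemma one_way_le_value_bound M : 1 <= M -> (M + 1) ^ (2 * M + 4) <= value_bound M.
Proof. intros; apply Z.pow_le_mono_r; nia. Qed.

Lemma two_way_le_value_bound M m E : 1 <= M -> 0 < m <= M * M + 2 * M -> E <= M * M + 3 * M ->
  2 * (M + 1) ^ (m + 1) + M + E <= value_bound M.
Proof.
  intros HM Hm HE; unfold value_bound.
  replace (M * M + 2 * M + 4) with (M * M + 2 * M + 1 + 3) by lia.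
  rewrite (Z.pow_add_r _ _ 3) by nia.
  assert (H1 : (M + 1) ^ (m + 1) <= (M + 1) ^ (M * M + 2 * M + 1))
    by (apply Z.pow_le_mono_r; lia).
  pose proof (Z.pow_pos_nonneg (M + 1) (m + 1) ltac:(lia) ltac:(lia)).
  set (X := (M + 1) ^ (M * M + 2 * M + 1)) in *.
  assert (M * M + 4 * M + 2 <= (M + 1) ^ 3) by nia.
  nia.
Qed.

Lemma no_translation_le_value_bound M : 1 <= M -> M * M + 4 * M <= value_bound M.
Proof.
  intros HM; pose proof (two_way_le_value_bound M 1 (M * M + 3 * M) HM ltac:(nia) ltac:(lia)) as H.
  pose proof (Z.pow_nonneg (M + 1) (1 + 1) ltac:(lia)). lia.
Qed.

(** Repeating b exactly -c times and c exactly b times gives shifts by b * -c in both directions. *)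
Lemma breach_opposite_translations M F b c : 1 <= M -> bounded_coeffs M F ->
  In (1, b) F -> In (1, c) F -> 0 < b -> c < 0 ->
  forall l x, incl l F -> Z.abs x <= M -> Z.abs (compose_apply l x) <= M ->
  breach F (value_bound M) x (compose_apply l x).
Proof.
  intros HM HF Hb Hc Hb0 Hc0 l x Hl Hx Hy.
  destruct (HF _ Hb) as [_ HbM]; destruct (HF _ Hc) as [_ HcM]; simpl in HbM, HcM.
  eapply breach_mono; [apply incl_refl| |apply (breach_two_way M F (b * - c) (b * - c)); auto].
  - apply two_way_le_value_bound; nia.
  - nia.
  - nia.
  - intros z; pose proof (breach_translate F b Hb (Z.to_nat (- c)) z) as H.
    rewrite Z2Nat.id in H by lia.
    replace (z + b * - c) with (z + - c * b) by ring.
    eapply breach_mono; [apply incl_refl| |apply H]; nia.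
  - intros z; pose proof (breach_translate F c Hc (Z.to_nat b) z) as H.
    rewrite Z2Nat.id in H by lia.
    replace (z - b * - c) with (z + b * c) by ring.
    eapply breach_mono; [apply incl_refl| |apply H]; nia.
Qed.

Ltac run_word w :=
  match w with
  | nil => apply breach_refl
  | cons ?t ?w' => apply breach_step with (s := t); [|assumption|unfold aff_apply at 1; simpl fst; simpl snd; run_word w']
  end.

(** A reflection conjugates a translation to its inverse, so three letters undo a shift by b. *)
Lemma breach_translation_reflection M F b c : 1 <= M -> bounded_coeffs M F ->
  In (1, b) F -> In (-1, c) F -> b <> 0 ->
  forall l x, incl l F -> Z.abs x <= M -> Z.abs (compose_apply l x) <= M ->
  breach F (value_bound M) x (compose_apply l x).
Proof.
  intros HM HF Hb Hc Hb0 l x Hl Hx Hy.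
  destruct (HF _ Hb) as [_ HbM]; destruct (HF _ Hc) as [_ HcM]; simpl in HbM, HcM.
  assert (Hplus : forall z, breach F (Z.abs z + 3 * M) z (z + b)).
  { intros z; pose proof (breach_translate F b Hb 1 z) as H.
    rewrite !Z.mul_1_l in H. eapply breach_mono; [apply incl_refl| |apply H]; lia. }
  assert (Hminus : forall z, breach F (Z.abs z + 3 * M) z (z - b)).
  { intros z.
    replace (z - b) with (-1 * (1 * (-1 * z + c) + b) + c) by ring.
    run_word [(-1, c); (1, b); (-1, c)]; lia. }
  eapply breach_mono; [apply incl_refl| |apply (breach_two_way M F (Z.abs b) (3 * M)); auto].
  - apply two_way_le_value_bound; nia.
  - lia.
  - lia.
  - intros z; destruct (Z_lt_le_dec b 0).
    + replace (z + Z.abs b) with (z - b) by lia. apply Hminus.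
    + replace (z + Z.abs b) with (z + b) by lia. apply Hplus.
  - intros z; destruct (Z_lt_le_dec b 0).
    + replace (z - Z.abs b) with (z + b) by lia. apply Hplus.
    + replace (z - Z.abs b) with (z - b) by lia. apply Hminus.
Qed.

(** Two reflections compose to a translation by the difference of their constants; the order of
    composition decides its direction. *)
Lemma breach_two_reflections M F b c : 1 <= M -> bounded_coeffs M F ->
  In (-1, b) F -> In (-1, c) F -> b < c ->
  forall l x, incl l F -> Z.abs x <= M -> Z.abs (compose_apply l x) <= M ->
  breach F (value_bound M) x (compose_apply l x).
Proof.
  intros HM HF Hb Hc Hbc l x Hl Hx Hy.
  destruct (HF _ Hb) as [_ HbM]; destruct (HF _ Hc) as [_ HcM]; simpl in HbM, HcM.
  eapply breach_mono; [apply incl_refl| |apply (breach_two_way M F (c - b) (3 * M)); auto].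
  - apply two_way_le_value_bound; nia.
  - lia.
  - lia.
  - intros z; replace (z + (c - b)) with (-1 * (-1 * z + b) + c) by ring.
    run_word [(-1, b); (-1, c)]; lia.
  - intros z; replace (z - (c - b)) with (-1 * (-1 * z + c) + b) by ring.
    run_word [(-1, c); (-1, b)]; lia.
Qed.

(** * Case distinction on the maps of slope 1 and -1 *)

Lemma find_or_all {A : Type} (P Q : A -> Prop) (dec : forall a, {P a} + {Q a}) (l : list A) :
  (exists a, In a l /\ P a) \/ (forall a, In a l -> Q a).
Proof.
  induction l as [|a l [(b & Hb & Hp)|IH]].
  - right; intros ? [].
  - left; exists b; split; [right|]; auto.
  - destruct (dec a); [left; exists a; split; [left|]; auto|right].
    intros b [<-|Hb]; auto.
Qed.

Lemma bounded_coeffs_negate M F : bounded_coeffs M F -> bounded_coeffs M (map negate F).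
Proof.
  intros HF s Hs; apply in_map_iff in Hs; destruct Hs as (t & <- & Ht).
  destruct (HF t Ht); unfold negate; simpl; lia.
Qed.

(** Only the maps of slope 1 and -1 select the case. Next to one reflection, a nontrivial
    translation or a different reflection already gives shifts both ways. Without reflections, the
    signs of the translations decide. *)
Lemma breach_no_reset M F : 1 <= M -> bounded_coeffs M F -> (forall s, In s F -> fst s <> 0) ->
  forall l x, incl l F -> Z.abs x <= M -> Z.abs (compose_apply l x) <= M ->
  breach F (value_bound M) x (compose_apply l x).
Proof.
  intros HM HF Hnc.
  destruct (find_or_all (fun s : Z * Z => fst s = -1) (fun s => fst s <> -1)
    (fun s => Z.eq_dec (fst s) (-1)) F) as [([a c] & Hc & Hc1)|Hnr].
  - simpl in Hc1; subst a.
    destruct (find_or_all (fun s : Z * Z => fst s = 1 /\ snd s <> 0) (fun s => fst s = 1 -> snd s = 0)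
      (fun s => ltac:(destruct (Z.eq_dec (fst s) 1), (Z.eq_dec (snd s) 0);
        (left; split; assumption) || (right; intros; (assumption || contradiction)))) F)
      as [([a b] & Hb & Hb1 & Hb2)|Hnt].
    { simpl in Hb1, Hb2; subst a; apply breach_translation_reflection with (b := b) (c := c); auto. }
    destruct (find_or_all (fun s : Z * Z => fst s = -1 /\ snd s <> c) (fun s => fst s = -1 -> snd s = c)
      (fun s => ltac:(destruct (Z.eq_dec (fst s) (-1)), (Z.eq_dec (snd s) c);
        (left; split; assumption) || (right; intros; (assumption || contradiction)))) F)
      as [([a b] & Hb & Hb1 & Hb2)|Hnr].
    { simpl in Hb1, Hb2; subst a.
      destruct (Z_lt_le_dec b c).
      - apply breach_two_reflections with (b := b) (c := c); auto.
      - apply breach_two_reflections with (b := c) (c := b); auto; lia. }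
    intros l x Hl Hx Hy.
    eapply breach_mono; [apply incl_refl|apply no_translation_le_value_bound; auto|].
    apply breach_no_translation with (c := c); auto.
    { destruct (HF _ Hc); auto. }
    intros s Hs; specialize (Hnt s Hs); specialize (Hnr s Hs); specialize (Hnc s Hs).
    destruct s as [a b]; simpl in *.
    destruct (Z.eq_dec a 1) as [->|]; [right; left; f_equal; auto|].
    destruct (Z.eq_dec a (-1)) as [->|]; [right; right; f_equal; auto|].
    left; lia.
  - destruct (find_or_all (fun s : Z * Z => fst s = 1 /\ 0 < snd s) (fun s => fst s = 1 -> snd s <= 0)
      (fun s => ltac:(destruct (Z.eq_dec (fst s) 1), (Z_lt_le_dec 0 (snd s));
        (left; split; assumption) || (right; intros; (assumption || contradiction)))) F)
      as [([a b] & Hb & Hb1 & Hb2)|Hnp];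
    destruct (find_or_all (fun s : Z * Z => fst s = 1 /\ snd s < 0) (fun s => fst s = 1 -> 0 <= snd s)
      (fun s => ltac:(destruct (Z.eq_dec (fst s) 1), (Z_lt_le_dec (snd s) 0);
        (left; split; assumption) || (right; intros; (assumption || contradiction)))) F)
      as [([a' c] & Hc & Hc1 & Hc2)|Hnn]; simpl in *; subst.
    + apply breach_opposite_translations with (b := b) (c := c); auto.
    + intros l x Hl Hx Hy.
      eapply breach_mono; [apply incl_refl|apply one_way_le_value_bound; auto|].
      apply breach_one_way with (g := b); auto.
      intros s Hs; specialize (Hnn s Hs); specialize (Hnr s Hs); specialize (Hnc s Hs).
      destruct (Z.eq_dec (fst s) 1); [right; auto|left; lia].
    + intros l x Hl Hx Hy.
      apply breach_negate_inv; rewrite <- compose_negate.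
      eapply breach_mono; [apply incl_refl|apply one_way_le_value_bound; auto|].
      apply breach_one_way with (g := - c).
      * auto.
      * apply bounded_coeffs_negate; auto.
      * intros s Hs; apply in_map_iff in Hs; destruct Hs as (t & <- & Ht).
        specialize (Hnp t Ht); specialize (Hnr t Ht); specialize (Hnc t Ht).
        unfold negate; simpl.
        destruct (Z.eq_dec (fst t) 1) as [E|]; [right; specialize (Hnp E); lia|left; lia].
      * change (1, - c) with (negate (1, c)); apply in_map; auto.
      * lia.
      * intros t Ht; apply in_map_iff in Ht; destruct Ht as (u & <- & Hu); apply in_map; auto.
      * lia.
      * rewrite compose_negate; lia.
    + intros l x Hl Hx Hy.
      eapply breach_mono; [apply incl_refl|apply no_translation_le_value_bound; auto|].
      (* There is no reflection here, so the centre can be chosen freely, and 0 is taken. *)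
      apply breach_no_translation with (c := 0); auto; [lia|].
      intros s Hs; specialize (Hnp s Hs); specialize (Hnn s Hs);
      specialize (Hnr s Hs); specialize (Hnc s Hs).
      destruct s as [a b]; simpl in *.
      destruct (Z.eq_dec a 1) as [->|]; [right; left; f_equal; lia|left; lia].
Qed.

Lemma last_reset (F : list (Z * Z)) : forall l x, incl l F ->
  (forall s, In s l -> fst s <> 0) \/
  exists b l', In (0, b) F /\ incl l' F /\ (forall s, In s l' -> fst s <> 0) /\
    compose_apply l x = compose_apply l' b.
Proof.
  induction l as [|s l IH]; intros x Hl; [left; intros ? []|].
  assert (Hl' : incl l F) by (intros t Ht; apply Hl; right; auto).
  destruct (IH (aff_apply s x) Hl') as [Hnc|(b & l' & H)].
  - destruct s as [a b]; destruct (Z.eq_dec a 0) as [->|Ha].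
    + right; exists b, l; split; [apply Hl; left; auto|split; [auto|split; [auto|]]].
      unfold compose_apply; simpl fold_left; f_equal; unfold aff_apply; simpl fst; simpl snd; lia.
    + left; intros t [<-|Ht]; auto.
  - right; exists b, l'; auto.
Qed.

(** A constant map gives the same value everywhere, so the last one can be applied directly at [x];
    this replaces all of the path before it by a single step, and the rest uses nonzero slopes
    only. *)
Theorem reach_bounded M F x y : 1 <= M -> bounded_coeffs M F -> Z.abs x <= M -> Z.abs y <= M ->
  reach F x y -> breach F (value_bound M) x y.
Proof.
  intros HM HF Hx Hy (l & Hl & <-).
  set (G := filter (fun s => negb (fst s =? 0)) F).
  assert (HG : incl G F) by apply incl_filter.
  assert (HGM : bounded_coeffs M G) by (intros s Hs; apply HF, HG, Hs).
  assert (HG0 : forall s, In s G -> fst s <> 0).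
  { intros s Hs; apply filter_In in Hs; destruct Hs as [_ Hs].
    destruct (Z.eqb_spec (fst s) 0); [discriminate|auto]. }
  assert (Hin : forall l', incl l' F -> (forall s, In s l' -> fst s <> 0) -> incl l' G).
  { intros l' Hi Hn s Hs; apply filter_In; split; auto.
    destruct (Z.eqb_spec (fst s) 0); [exfalso; apply (Hn s Hs); auto|auto]. }
  destruct (last_reset F l x Hl) as [Hn|(b & l' & Hb & Hl' & Hn & He)].
  - eapply breach_mono; [exact HG|apply Z.le_refl|]. apply breach_no_reset; auto.
  - rewrite He in *.
    destruct (HF _ Hb) as [_ HbM]; simpl in HbM.
    apply breach_step with (s := (0, b)); auto.
    + pose proof (no_translation_le_value_bound M HM); nia.
    + replace (aff_apply (0, b) x) with b by (unfold aff_apply; simpl fst; simpl snd; lia).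
      eapply breach_mono; [exact HG|apply Z.le_refl|]. apply breach_no_reset; auto.
Qed.

(** Loop removal on the 2B + 1 integers of the interval. The resulting length is what bounds the
    number of saturation rounds. *)
Lemma breach_short F B x y : breach F B x y ->
  exists l, incl l F /\ (Z.of_nat (length l) <= 2 * B + 1) /\ compose_apply l x = y /\
    along apply_to (fun c => Z.abs c <= B) x l.
Proof.
  intros H.
  assert (Hex : exists l, incl l F /\ compose_apply l x = y /\
    along apply_to (fun c => Z.abs c <= B) x l).
  { induction H as [u Hu|u s v Hu Hs H (l & H1 & H2 & H3)].
    - exists []; repeat split; auto using incl_nil_l.
    - exists (s :: l); repeat split; auto. intros t [<-|Ht]; auto. }
  destruct Hex as (l & H1 & H2 & H3).
  pose proof (breach_bound_l _ _ _ _ H) as HB.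
  set (U := map (fun i => Z.of_nat i - B) (seq 0 (Z.to_nat (2 * B + 1)))).
  assert (HU : forall c, In c U <-> Z.abs c <= B).
  { intros c; unfold U; rewrite in_map_iff; split.
    - intros (i & <- & Hi); apply in_seq in Hi; lia.
    - intros Hc; exists (Z.to_nat (c + B)); split; [lia|apply in_seq; lia]. }
  destruct (loop_removal apply_to Z.eq_dec U l x) as (l' & I1 & I2 & I3 & I4).
  { revert H3; apply along_impl; intros; apply HU; auto. }
  exists l'; repeat split.
  - eapply incl_tran; eauto.
  - unfold U in I2; rewrite length_map, length_seq in I2; lia.
  - rewrite <- H2; exact I3.
  - revert I4; apply along_impl; intros; apply HU; auto.
Qed.

Open Scope nat_scope.

(** * Structured programs for a single tape *)

(** An intermediate language whose tests and updates see only the scanned symbol, so that each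
    construct contributes at most two rows of its own to the transition table. *)
Inductive tprog :=
| TSkip
| TUpd (g : nat -> nat)
| TL
| TR
| TSeq (a b : tprog)
| TIf (p : nat -> bool) (a b : tprog)
| TWhile (p : nat -> bool) (a : tprog).

Definition upd (f : nat -> nat) (p w : nat) : nat -> nat :=
  fun q => if q =? p then w else f q.

(* The head never moves to the left of cell 0; the last argument bounds the number of machine steps. *)
Inductive ev (ns : nat) : tprog -> (nat -> nat) -> nat -> (nat -> nat) -> nat -> nat -> Prop :=
| ev_skip f p : ev ns TSkip f p f p 0
| ev_upd g f p : g (f p) < ns -> ev ns (TUpd g) f p (upd f p (g (f p))) p 1
| ev_left f p : ev ns TL f (S p) f p 1
| ev_right f p : ev ns TR f p f (S p) 1
| ev_seq a b f p f1 p1 f2 p2 t1 t2 :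
    ev ns a f p f1 p1 t1 -> ev ns b f1 p1 f2 p2 t2 -> ev ns (TSeq a b) f p f2 p2 (t1 + t2)
| ev_if_true g a b f p f' p' t :
    g (f p) = true -> ev ns a f p f' p' t -> ev ns (TIf g a b) f p f' p' (2 + t)
| ev_if_false g a b f p f' p' t :
    g (f p) = false -> ev ns b f p f' p' t -> ev ns (TIf g a b) f p f' p' (2 + t)
| ev_while_false g a f p : g (f p) = false -> ev ns (TWhile g a) f p f p 1
| ev_while_true g a f p f1 p1 f2 p2 t1 t2 :
    g (f p) = true -> ev ns a f p f1 p1 t1 -> ev ns (TWhile g a) f1 p1 f2 p2 t2 ->
    ev ns (TWhile g a) f p f2 p2 (2 + t1 + t2).

Lemma ev_time ns c f p f' p' t u : t = u -> ev ns c f p f' p' t -> ev ns c f p f' p' u.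
Proof. now intros ->. Qed.

Fixpoint tsize (c : tprog) : nat :=
  match c with
  | TSkip => 0
  | TUpd _ | TL | TR => 1
  | TSeq a b => tsize a + tsize b
  | TIf _ a b => 2 + tsize a + tsize b
  | TWhile _ a => 2 + tsize a
  end.

Definition row := nat -> nat * nat * move.

Definition jump (q : nat) : row := fun s => (q, s, Stay).

(** Code for [c] is entered in state [base] and left in state [base + tsize c], so sequencing needs
    no jump. The reduction modulo [ns] keeps written symbols in the alphabet; it changes nothing in
    runs described by [ev]. *)
Fixpoint assemble (ns base : nat) (c : tprog) : list row :=
  match c with
  | TSkip => []
  | TUpd g => [fun s => (base + 1, g s mod ns, Stay)]
  | TL => [fun s => (base + 1, s, MoveL)]
  | TR => [fun s => (base + 1, s, MoveR)]
  | TSeq a b => assemble ns base a ++ assemble ns (base + tsize a) b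
  | TIf g a b =>
      (fun s => (if g s then base + 1 else base + 2 + tsize a, s, Stay))
      :: assemble ns (base + 1) a
      ++ jump (base + 2 + tsize a + tsize b) :: assemble ns (base + 2 + tsize a) b
  | TWhile g a =>
      (fun s => (if g s then base + 1 else base + 2 + tsize a, s, Stay))
      :: assemble ns (base + 1) a ++ [jump base]
  end.

Lemma length_assemble ns c : forall base, length (assemble ns base c) = tsize c.
Proof.
  induction c; intros base; simpl; auto;
    repeat (rewrite length_app; simpl); rewrite ?IHc, ?IHc1, ?IHc2; lia.
Qed.

Definition row_wf (ns n : nat) (r : row) : Prop :=
  forall s, s < ns -> match r s with (q, w, _) => q <= n /\ w < ns end.

Lemma assemble_wf ns c : forall base n, base + tsize c <= n ->
  Forall (row_wf ns n) (assemble ns base c).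
Proof.
  induction c; intros base n Hn; simpl in *;
    repeat first [apply Forall_app; split | apply Forall_cons | apply Forall_nil];
    try (apply IHc || apply IHc1 || apply IHc2; lia);
    intros s Hs; simpl; try (destruct (p s)); try (split; lia).
  split; [lia|apply Nat.mod_upper_bound; lia].
Qed.

(** * Simulation of structured programs by the machine *)

Definition code_at (rows : list row) (base : nat) (c : list row) : Prop :=
  forall i r, nth_error c i = Some r -> nth_error rows (base + i) = Some r.

Lemma code_at_app rows base c d : code_at rows base (c ++ d) ->
  code_at rows base c /\ code_at rows (base + length c) d.
Proof.
  intros H; split; intros i r Hi.
  - apply H; rewrite nth_error_app1; auto. apply nth_error_Some; congruence.
  - rewrite <- Nat.add_assoc; apply H; rewrite nth_error_app2 by lia.
    rewrite <- Hi; f_equal; lia.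
Qed.

Lemma code_at_cons rows base r c : code_at rows base (r :: c) ->
  nth_error rows base = Some r /\ code_at rows (base + 1) c.
Proof.
  intros H; split.
  - rewrite <- (Nat.add_0_r base); apply H; reflexivity.
  - intros i r' Hi; rewrite <- Nat.add_assoc; apply H; exact Hi.
Qed.

(** The code exits in state [length rows], which has no row: the default branch then reads the
    scanned symbol and accepts or rejects by [acc]. The two states after it are the halting ones. *)
Definition machine (ns : nat) (acc : nat -> bool) (rows : list row) : TM :=
  {| nstates := length rows + 3;
     nsyms := ns;
     delta := fun q s =>
       match nth_error rows q with
       | Some r => r s
       | None => (if acc s then length rows + 1 else length rows + 2, s, Stay)
       end;
     q0 := 0;
     qacc := length rows + 1;
     qrej := length rows + 2 |}.

Lemma machine_wf ns acc rows : 5 <= ns -> Forall (row_wf ns (length rows)) rows ->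
  TM_wf (machine ns acc rows).
Proof.
  intros Hns Hrows; unfold TM_wf; simpl.
  do 5 (split; [lia|]); intros q s Hq Hs.
  destruct (nth_error rows q) as [r|] eqn:E.
  - rewrite Forall_forall in Hrows; apply nth_error_In in E.
    specialize (Hrows r E s Hs); destruct (r s) as [[q' w] m]; lia.
  - destruct (acc s); lia.
Qed.

(** The default 0 of [nth] identifies the end of a list with blank tape. Only the first [p] entries
    on the left are constrained, because nothing lies to the left of cell 0. *)
Definition shows (q : nat) (f : nat -> nat) (p : nat) (c : config) : Prop :=
  cst c = q /\ ccur c = f p /\
  (forall i, i < p -> nth i (cleft c) 0 = f (p - 1 - i)) /\
  (forall i, nth i (cright c) 0 = f (p + 1 + i)).

Lemma step_active ns acc rows c : cst c <= length rows ->
  step (machine ns acc rows) c =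
  match delta (machine ns acc rows) (cst c) (ccur c) with
  | (q', w, MoveL) =>
      match cleft c with
      | [] => mkConfig q' [] 0 (w :: cright c)
      | a :: l => mkConfig q' l a (w :: cright c)
      end
  | (q', w, MoveR) =>
      match cright c with
      | [] => mkConfig q' (w :: cleft c) 0 []
      | a :: r => mkConfig q' (w :: cleft c) a r
      end
  | (q', w, Stay) => mkConfig q' (cleft c) w (cright c)
  end.
Proof.
  intros H; unfold step at 1.
  replace (cst c =? qacc (machine ns acc rows)) with false
    by (symmetry; apply Nat.eqb_neq; simpl; lia).
  replace (cst c =? qrej (machine ns acc rows)) with false
    by (symmetry; apply Nat.eqb_neq; simpl; lia).
  reflexivity.
Qed.

Lemma step_stay ns acc rows q f p c q' w : shows q f p c -> q <= length rows ->
  delta (machine ns acc rows) q (f p) = (q', w, Stay) ->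
  shows q' (upd f p w) p (step (machine ns acc rows) c).
Proof.
  intros (Hq & Hc & Hl & Hr) Hlt Hd.
  rewrite step_active by lia; rewrite Hq, Hc, Hd.
  unfold upd; split; [|split; [|split]]; simpl; auto.
  - now rewrite Nat.eqb_refl.
  - intros i Hi; rewrite Hl by auto. destruct (Nat.eqb_spec (p - 1 - i) p); [lia|auto].
  - intros i; rewrite Hr. destruct (Nat.eqb_spec (p + 1 + i) p); [lia|auto].
Qed.

Lemma upd_same f p : upd f p (f p) = f.
Proof.
  apply functional_extensionality; intros q; unfold upd.
  destruct (Nat.eqb_spec q p); congruence.
Qed.

Lemma step_right ns acc rows q f p c q' : shows q f p c -> q <= length rows ->
  delta (machine ns acc rows) q (f p) = (q', f p, MoveR) ->
  shows q' f (S p) (step (machine ns acc rows) c).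
Proof.
  intros (Hq & Hc & Hl & Hr) Hlt Hd.
  rewrite step_active by lia; rewrite Hq, Hc, Hd.
  assert (Hleft : forall i, i < S p -> nth i (f p :: cleft c) 0 = f (S p - 1 - i)).
  { intros [|i] Hi; simpl; [f_equal; lia|rewrite Hl by lia; f_equal; lia]. }
  destruct (cright c) as [|a r]; (split; [|split; [|split]]); simpl in *; auto.
  - etransitivity; [exact (Hr 0)|f_equal; lia].
  - intros i; etransitivity; [|etransitivity; [exact (Hr (S i))|f_equal; lia]]; now destruct i.
  - etransitivity; [exact (Hr 0)|f_equal; lia].
  - intros i; etransitivity; [exact (Hr (S i))|f_equal; lia].
Qed.

Lemma step_left ns acc rows q f p c q' : shows q f (S p) c -> q <= length rows ->
  delta (machine ns acc rows) q (f (S p)) = (q', f (S p), MoveL) ->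
  shows q' f p (step (machine ns acc rows) c).
Proof.
  intros (Hq & Hc & Hl & Hr) Hlt Hd.
  rewrite step_active by lia; rewrite Hq, Hc, Hd.
  assert (Hright : forall i, nth i (f (S p) :: cright c) 0 = f (p + 1 + i)).
  { intros [|i]; simpl; [f_equal; lia|rewrite Hr; f_equal; lia]. }
  destruct (cleft c) as [|a r]; (split; [|split; [|split]]); simpl in *; auto.
  - etransitivity; [exact (Hl 0 ltac:(lia))|f_equal; lia].
  - intros i Hi; etransitivity; [|etransitivity; [exact (Hl (S i) ltac:(lia))|f_equal; lia]].
    now destruct i.
  - etransitivity; [exact (Hl 0 ltac:(lia))|f_equal; lia].
  - intros i Hi; etransitivity; [exact (Hl (S i) ltac:(lia))|f_equal; lia].
Qed.

(** The count in [ev] is only an upper bound: a conditional is charged for a test and a jump, but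
    its false branch runs into the exit without a jump. *)
Lemma machine_simulates ns acc rows c f p f' p' t : ev ns c f p f' p' t ->
  forall base cf, code_at rows base (assemble ns base c) -> shows base f p cf ->
  exists t', t' <= t /\
    shows (base + tsize c) f' p' (Nat.iter t' (step (machine ns acc rows)) cf).
Proof.
  set (M := machine ns acc rows).
  assert (Hlen : forall q r, nth_error rows q = Some r -> q <= length rows).
  { intros q r Hq; enough (q < length rows) by lia. apply nth_error_Some; congruence. }
  assert (Hdelta : forall q r s, nth_error rows q = Some r -> delta M q s = r s).
  { intros q r s Hq; simpl; now rewrite Hq. }
  assert (Hjump : forall q q' f p cf, nth_error rows q = Some (jump q') -> shows q f p cf ->
    shows q' f p (step M cf)).
  { intros q q' g k cf Hq Hs; rewrite <- (upd_same g k).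
    eapply step_stay; eauto. fold M; erewrite Hdelta by eauto; reflexivity. }
  assert (Htest : forall q (g : nat -> bool) a b f p cf,
    nth_error rows q = Some (fun s => (if g s then a else b, s, Stay)) -> shows q f p cf ->
    shows (if g (f p) then a else b) f p (step M cf)).
  { intros q g a b h k cf Hq Hs; rewrite <- (upd_same h k) at 2.
    eapply step_stay; eauto. fold M; erewrite Hdelta by eauto; reflexivity. }
  induction 1 as [f p|g f p Hg|f p|f p|a b f p f1 p1 f2 p2 t1 t2 _ IH1 _ IH2
    |g a b f p f' p' t Hg _ IH|g a b f p f' p' t Hg _ IH|g a f p Hg
    |g a f p f1 p1 f2 p2 t1 t2 Hg _ IH1 _ IH2]; intros base cf Hcode Hs; simpl in Hcode.
  - exists 0; split; auto. simpl; now rewrite Nat.add_0_r.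
  - apply code_at_cons in Hcode as [Hrow _].
    exists 1; split; auto. simpl.
    eapply step_stay; eauto. fold M; erewrite Hdelta by eauto. simpl.
    now rewrite Nat.mod_small by auto.
  - apply code_at_cons in Hcode as [Hrow _].
    exists 1; split; auto. simpl.
    eapply step_left; eauto. fold M; erewrite Hdelta by eauto; reflexivity.
  - apply code_at_cons in Hcode as [Hrow _].
    exists 1; split; auto. simpl.
    eapply step_right; eauto. fold M; erewrite Hdelta by eauto; reflexivity.
  - apply code_at_app in Hcode as [Ha Hb]; rewrite length_assemble in Hb.
    destruct (IH1 base cf Ha Hs) as (u1 & Hu1 & Hs1).
    destruct (IH2 _ _ Hb Hs1) as (u2 & Hu2 & Hs2).
    exists (u2 + u1); split; [lia|].
    rewrite Nat.iter_add; simpl; now rewrite Nat.add_assoc.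
  - apply code_at_cons in Hcode as [Hrow Hcode]; apply code_at_app in Hcode as [Ha Hb].
    apply code_at_cons in Hb as [Hj Hb]; rewrite length_assemble in *.
    apply (Htest _ _ _ _ _ _ _ Hrow) in Hs; rewrite Hg in Hs.
    destruct (IH _ _ Ha Hs) as (u & Hu & Hs1).
    exists (1 + (u + 1)); split; [lia|].
    rewrite !Nat.iter_add; simpl.
    replace (base + S (S (tsize a + tsize b))) with (base + 2 + tsize a + tsize b) by lia.
    eapply Hjump; [exact Hj|exact Hs1].
  - apply code_at_cons in Hcode as [Hrow Hcode]; apply code_at_app in Hcode as [Ha Hb].
    apply code_at_cons in Hb as [Hj Hb]; rewrite length_assemble in *.
    apply (Htest _ _ _ _ _ _ _ Hrow) in Hs; rewrite Hg in Hs.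
    replace (base + 1 + tsize a + 1) with (base + 2 + tsize a) in Hb by lia.
    destruct (IH _ _ Hb Hs) as (u & Hu & Hs1).
    exists (u + 1); split; [lia|].
    rewrite !Nat.iter_add; simpl.
    replace (base + S (S (tsize a + tsize b))) with (base + 2 + tsize a + tsize b) by lia.
    exact Hs1.
  - apply code_at_cons in Hcode as [Hrow Hcode].
    apply (Htest _ _ _ _ _ _ _ Hrow) in Hs; rewrite Hg in Hs.
    exists 1; split; auto. simpl.
    replace (base + S (S (tsize a))) with (base + 2 + tsize a) by lia. exact Hs.
  - pose proof Hcode as Hcode0.
    apply code_at_cons in Hcode as [Hrow Hcode]; apply code_at_app in Hcode as [Ha Hb].
    apply code_at_cons in Hb as [Hj _]; rewrite length_assemble in *.
    apply (Htest _ _ _ _ _ _ _ Hrow) in Hs; rewrite Hg in Hs.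
    destruct (IH1 _ _ Ha Hs) as (u1 & Hu1 & Hs1).
    apply (Hjump _ _ _ _ _ Hj) in Hs1.
    destruct (IH2 _ _ Hcode0 Hs1) as (u2 & Hu2 & Hs2).
    exists (u2 + (1 + (u1 + 1))); split; [lia|].
    rewrite !Nat.iter_add; exact Hs2.
Qed.

(** * Bounded loop programs *)

(* Register 0 always holds 0. Register 1 is the limit of all registers: Inc stops there. *)
Inductive cmd :=
| Skip
| Inc (r : nat)
| Dec (r : nat)
| Copy (r t : nat)
| Extend
| SetB (r b : nat)
| Seq (c d : cmd)
| IfEq (r r' : nat) (c d : cmd)
| IfB (r b : nat) (c d : cmd)
| Loop (r : nat) (c : cmd).

Record state := mkState { rg : nat -> nat; mm : nat -> nat -> bool }.

Definition rset (s : state) (r v : nat) : state :=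
  mkState (fun i => if i =? r then v else rg s i) (mm s).

Definition mset (s : state) (p b : nat) : state :=
  mkState (rg s) (fun q k => ((q =? p) && (k =? b)) || mm s q k).

Fixpoint exec (c : cmd) (s : state) : state :=
  match c with
  | Skip => s
  | Inc r => if rg s r =? rg s 1 then s else rset s r (S (rg s r))
  | Dec r => rset s r (pred (rg s r))
  | Copy r t => rset s t (rg s r)
  | Extend => rset s 1 (S (rg s 1))
  | SetB r b => mset s (rg s r) b
  | Seq c d => exec d (exec c s)
  | IfEq r r' c d => if rg s r =? rg s r' then exec c s else exec d s
  | IfB r b c d => if mm s (rg s r) b then exec c s else exec d s
  | Loop r c => Nat.iter (rg s r) (exec c) s
  end.

(** Registers 0 and 1 are never targets, which protects the zero and the limit. [Copy] needs
    distinct registers because on the tape the mark of the target is erased before the source is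
    searched for. *)
Fixpoint cmd_wf (nr : nat) (c : cmd) : bool :=
  match c with
  | Skip | Extend => true
  | Inc r | Dec r => (2 <=? r) && (r <? nr)
  | Copy r t => (r <? nr) && (2 <=? t) && (t <? nr) && negb (r =? t)
  | SetB r b => (r <? nr) && (b <? 5)
  | Seq c d => cmd_wf nr c && cmd_wf nr d
  | IfEq r r' c d => (r <? nr) && (r' <? nr) && cmd_wf nr c && cmd_wf nr d
  | IfB r b c d => (r <? nr) && (b <? 5) && cmd_wf nr c && cmd_wf nr d
  | Loop r c => (r <? nr) && cmd_wf nr c
  end.

Fixpoint depth (c : cmd) : nat :=
  match c with
  | Seq c d | IfEq _ _ c d | IfB _ _ c d => Nat.max (depth c) (depth d)
  | Loop _ c => S (depth c)
  | _ => 0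
  end.

Definition limited (s : state) : Prop := rg s 0 = 0 /\ forall i, rg s i <= rg s 1.

(** Registers from [n] on are ignored: compiled loops keep their counters there, and the source
    program knows nothing of them. *)
Definition eqv (n : nat) (s s' : state) : Prop :=
  (forall i, i < n -> rg s i = rg s' i) /\ mm s = mm s'.

Lemma eqv_refl n s : eqv n s s.
Proof. split; auto. Qed.

Lemma eqv_trans n s1 s2 s3 : eqv n s1 s2 -> eqv n s2 s3 -> eqv n s1 s3.
Proof. intros [H1 H2] [H3 H4]; split; [|congruence]. intros; rewrite H1, H3; auto. Qed.

Lemma eqv_le n m s s' : m <= n -> eqv n s s' -> eqv m s s'.
Proof. intros Hle [H1 H2]; split; auto. intros; apply H1; lia. Qed.

Lemma eqv_rset n s s' r v : eqv n s s' -> eqv n (rset s r v) (rset s' r v).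
Proof.
  intros [H1 H2]; split; simpl; auto.
  intros i Hi; destruct (i =? r); auto.
Qed.

Lemma eqv_rset_above n s r v : n <= r -> eqv n (rset s r v) s.
Proof.
  intros Hr; split; simpl; auto.
  intros i Hi; destruct (Nat.eqb_spec i r); [lia|auto].
Qed.

Ltac split_wf H := cbn [cmd_wf] in H; repeat (apply andb_prop in H; destruct H as [H ?]);
  repeat match goal with
  | X : (_ <? _) = true |- _ => apply Nat.ltb_lt in X
  | X : (_ <=? _) = true |- _ => apply Nat.leb_le in X
  end.

Lemma iter_eqv n (g : state -> state) : (forall s s', eqv n s s' -> eqv n (g s) (g s')) ->
  forall k s s', eqv n s s' -> eqv n (Nat.iter k g s) (Nat.iter k g s').
Proof. intros Hg; induction k; intros; simpl; auto. Qed.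

Lemma exec_eqv nr n c : 2 <= nr -> nr <= n -> cmd_wf nr c = true -> forall s s',
  eqv n s s' -> eqv n (exec c s) (exec c s').
Proof.
  intros Hnr Hn; induction c; intros Hwf s s' He; split_wf Hwf; simpl; auto;
    pose proof He as [Hr Hm].
  - rewrite !(Hr r), !(Hr 1) by lia.
    destruct (_ =? _); auto using eqv_rset.
  - rewrite !(Hr r) by lia; auto using eqv_rset.
  - rewrite !(Hr r) by lia; auto using eqv_rset.
  - rewrite !(Hr 1) by lia; auto using eqv_rset.
  - rewrite !(Hr r) by lia; split; simpl; auto. now rewrite Hm.
  - rewrite !(Hr r), !(Hr r') by lia. destruct (_ =? _); auto.
  - rewrite !(Hr r), Hm by lia. destruct (mm s' _ b); auto.
  - rewrite !(Hr r) by lia. apply iter_eqv; auto.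
Qed.

(** Used to see that the counter of a loop survives the execution of its body. *)
Lemma exec_frame nr c : 2 <= nr -> cmd_wf nr c = true -> forall s i, nr <= i ->
  rg (exec c s) i = rg s i.
Proof.
  intros Hnr; induction c; intros Hwf s i Hi; split_wf Hwf; simpl; auto.
  - destruct (_ =? _); auto. simpl. destruct (Nat.eqb_spec i r); [lia|auto].
  - destruct (Nat.eqb_spec i r); [lia|auto].
  - destruct (Nat.eqb_spec i t); [lia|auto].
  - destruct (Nat.eqb_spec i 1); [lia|auto].
  - rewrite IHc2, IHc1; auto.
  - destruct (_ =? _); auto.
  - destruct (mm s _ b); auto.
  - induction (rg s r) as [|k IH]; simpl; auto. rewrite IHc; auto.
Qed.

(** The limit never decreases, so its final value bounds every register during the whole run and can
    serve as the measure of time. *)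
Lemma exec_limited nr c : 2 <= nr -> cmd_wf nr c = true -> forall s, limited s ->
  limited (exec c s) /\ rg s 1 <= rg (exec c s) 1.
Proof.
  intros Hnr; induction c; intros Hwf s Hs; split_wf Hwf; cbn [exec]; auto;
    pose proof Hs as [Hz Hle].
  - pose proof (Hle r). destruct (Nat.eqb_spec (rg s r) (rg s 1)); auto.
    split; [split|]; cbn [rset rg mm].
    + destruct (Nat.eqb_spec 0 r); [lia|auto].
    + intros i; destruct (Nat.eqb_spec 1 r), (Nat.eqb_spec i r); auto; lia.
    + destruct (Nat.eqb_spec 1 r); [lia|auto].
  - pose proof (Hle r). split; [split|]; cbn [rset rg mm].
    + destruct (Nat.eqb_spec 0 r); [lia|auto].
    + intros i; destruct (Nat.eqb_spec 1 r), (Nat.eqb_spec i r); auto; lia.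
    + destruct (Nat.eqb_spec 1 r); [lia|auto].
  - pose proof (Hle r). split; [split|]; cbn [rset rg mm].
    + destruct (Nat.eqb_spec 0 t); [lia|auto].
    + intros i; destruct (Nat.eqb_spec 1 t), (Nat.eqb_spec i t); auto; lia.
    + destruct (Nat.eqb_spec 1 t); [lia|auto].
  - split; [split|]; auto.
    + intros i; simpl; destruct (Nat.eqb_spec i 1); auto.
    + simpl; auto.
  - destruct (IHc1 ltac:(auto) s Hs) as [I1 I2]; destruct (IHc2 ltac:(auto) _ I1).
    split; auto; lia.
  - destruct (_ =? _); auto.
  - destruct (mm s _ b); auto.
  - induction (rg s r) as [|k [I1 I2]]; simpl; auto.
    destruct (IHc ltac:(auto) _ I1); split; auto; lia.
Qed.

(** * Loop programs on the tape *)

(* Cell p stores the memory bits in its five low-order bits; bit 5 + i marks the cell p = rg s i. *)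
Definition on_tape (nt : nat) (s : state) (f : nat -> nat) : Prop :=
  forall p b, Nat.testbit (f p) b =
    if b <? 5 then mm s p b else if b <? 5 + nt then rg s (b - 5) =? p else false.

Lemma lt_pow2_of_bits a k : (forall b, k <= b -> Nat.testbit a b = false) -> a < 2 ^ k.
Proof.
  intros H; rewrite <- (Nat.mod_small_iff a (2 ^ k)) by (apply Nat.pow_nonzero; lia).
  apply Nat.bits_inj; intros b.
  destruct (Nat.le_gt_cases k b).
  - rewrite Nat.mod_pow2_bits_high, H; auto.
  - now rewrite Nat.mod_pow2_bits_low by lia.
Qed.

Lemma on_tape_high nt s f p b : on_tape nt s f -> 5 + nt <= b -> Nat.testbit (f p) b = false.
Proof.
  intros H Hb; rewrite H.
  destruct (Nat.ltb_spec b 5); [lia|]; destruct (Nat.ltb_spec b (5 + nt)); [lia|auto].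
Qed.

Lemma on_tape_reg nt s f p r : on_tape nt s f -> r < nt ->
  Nat.testbit (f p) (5 + r) = (rg s r =? p).
Proof.
  intros H Hr; rewrite H.
  destruct (Nat.ltb_spec (5 + r) 5); [lia|]; destruct (Nat.ltb_spec (5 + r) (5 + nt)); [|lia].
  do 2 f_equal; lia.
Qed.

Lemma on_tape_mem nt s f p b : on_tape nt s f -> b < 5 -> Nat.testbit (f p) b = mm s p b.
Proof. intros H Hb; rewrite H. destruct (Nat.ltb_spec b 5); [auto|lia]. Qed.

(** Code for a command starts and ends with the head in cell 0. [goto] walks right to the mark of a
    register, and [home] walks left to the mark of register 0, which stays in cell 0. *)
Definition goto (r : nat) : tprog := TWhile (fun c => negb (Nat.testbit c (5 + r))) TR.
Definition home : tprog := TWhile (fun c => negb (Nat.testbit c 5)) TL.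
Definition clear_mark (r : nat) : tprog := TUpd (fun c => Nat.clearbit c (5 + r)).
Definition set_bit (b : nat) : tprog := TUpd (fun c => Nat.setbit c b).

Lemma ev_goto ns f r x p : (forall q, Nat.testbit (f q) (5 + r) = (x =? q)) -> p <= x ->
  ev ns (goto r) f p f x (3 * (x - p) + 1).
Proof.
  intros Hbit; remember (x - p) as k eqn:Hk; revert p Hk.
  induction k as [|k IH]; intros p Hk Hp.
  - replace x with p in * by lia.
    apply ev_while_false. now rewrite Hbit, Nat.eqb_refl.
  - eapply ev_time; [|eapply ev_while_true; [|apply ev_right|apply (IH (S p)); lia]]; [lia|].
    rewrite Hbit. destruct (Nat.eqb_spec x p); [lia|auto].
Qed.

Lemma ev_home ns f p : (forall q, Nat.testbit (f q) 5 = (0 =? q)) ->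
  ev ns home f p f 0 (3 * p + 1).
Proof.
  intros Hbit; induction p as [|p IH].
  - apply ev_while_false. now rewrite Hbit.
  - eapply ev_time; [|eapply ev_while_true; [|apply ev_left|apply IH]]; [lia|].
    now rewrite Hbit.
Qed.

Lemma on_tape_move nt s f r x y : on_tape nt s f -> r < nt -> rg s r = x ->
  let f1 := upd f x (Nat.clearbit (f x) (5 + r)) in
  on_tape nt (rset s r y) (upd f1 y (Nat.setbit (f1 y) (5 + r))).
Proof.
  intros Hs Hr Hx f1 p b.
  assert (H1 : forall q k, Nat.testbit (f1 q) k = Nat.testbit (f q) k && negb (5 + r =? k)).
  { intros q k; unfold f1, upd; destruct (Nat.eqb_spec q x) as [->|Hq].
    - apply Nat.clearbit_eqb.
    - destruct (Nat.eqb_spec (5 + r) k) as [<-|]; [|now rewrite andb_true_r].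
      rewrite (on_tape_reg _ _ _ _ _ Hs Hr), Hx, andb_false_r. apply Nat.eqb_neq; auto. }
  assert (H2 : forall q k, Nat.testbit (upd f1 y (Nat.setbit (f1 y) (5 + r)) q) k =
    if 5 + r =? k then y =? q else Nat.testbit (f q) k).
  { intros q k; unfold upd at 1; destruct (Nat.eqb_spec q y) as [->|Hq].
    - rewrite Nat.setbit_eqb, H1, Nat.eqb_refl. destruct (5 + r =? k); simpl; auto.
      now rewrite andb_true_r.
    - rewrite H1. destruct (5 + r =? k); simpl; [rewrite andb_false_r|now rewrite andb_true_r].
      symmetry; apply Nat.eqb_neq; auto. }
  rewrite H2, Hs; simpl rg; simpl mm.
  destruct (Nat.eqb_spec (5 + r) b) as [<-|Hb].
  - destruct (Nat.ltb_spec (5 + r) 5); [lia|]; destruct (Nat.ltb_spec (5 + r) (5 + nt)); [|lia].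
    replace (5 + r - 5) with r by lia. now rewrite Nat.eqb_refl.
  - destruct (Nat.ltb_spec b 5); auto. destruct (Nat.eqb_spec (b - 5) r); [lia|auto].
Qed.

(** The program [go] takes the head from the old cell to the new one while the mark is off the
    tape. *)
Definition move_mark (r : nat) (go : tprog) : tprog :=
  TSeq (goto r) (TSeq (clear_mark r) (TSeq go (TSeq (set_bit (5 + r)) home))).

Lemma ev_move_mark nt s f r go y t : on_tape nt s f -> 0 < r < nt -> rg s 0 = 0 ->
  (let f1 := upd f (rg s r) (Nat.clearbit (f (rg s r)) (5 + r)) in
   ev (2 ^ (5 + nt)) go f1 (rg s r) f1 y t) ->
  exists f' u, ev (2 ^ (5 + nt)) (move_mark r go) f 0 f' 0 u /\
    on_tape nt (rset s r y) f' /\ u = 3 * rg s r + 3 * y + t + 4.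
Proof.
  intros Hs Hr H0 Hgo; cbv zeta in Hgo.
  pose proof (on_tape_move nt s f r (rg s r) y Hs ltac:(lia) eq_refl) as Hm; cbv zeta in Hm.
  set (f1 := upd f (rg s r) (Nat.clearbit (f (rg s r)) (5 + r))) in *.
  set (f2 := upd f1 y (Nat.setbit (f1 y) (5 + r))) in *.
  exists f2; eexists; split; [|split; [exact Hm|]].
  - unfold move_mark.
    eapply ev_seq.
    { apply (ev_goto _ f r (rg s r)); [|lia]. intros q; apply (on_tape_reg nt); auto; lia. }
    eapply ev_seq.
    { apply (ev_upd _ (fun c => Nat.clearbit c (5 + r))).
      apply lt_pow2_of_bits; intros b Hb; rewrite Nat.clearbit_eqb.
      now rewrite (on_tape_high nt s). }
    eapply ev_seq; [exact Hgo|].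
    eapply ev_seq.
    { apply (ev_upd _ (fun c => Nat.setbit c (5 + r))).
      apply lt_pow2_of_bits; intros b Hb.
      replace (Nat.setbit (f1 y) (5 + r)) with (f2 y) by (unfold f2, upd; now rewrite Nat.eqb_refl).
      now rewrite (on_tape_high nt _ _ _ _ Hm). }
    apply ev_home; intros q; etransitivity; [exact (on_tape_reg nt _ f2 q 0 Hm ltac:(lia))|].
    simpl; destruct r; [lia|]. now rewrite H0.
  - lia.
Qed.

Lemma on_tape_mset nt s f p b : on_tape nt s f -> b < 5 ->
  on_tape nt (mset s p b) (upd f p (Nat.setbit (f p) b)).
Proof.
  intros Hs Hb q k; unfold upd; simpl rg; simpl mm.
  destruct (Nat.eqb_spec q p) as [->|Hq]; simpl.
  - rewrite Nat.setbit_eqb, Hs, (Nat.eqb_sym b k).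
    destruct (Nat.eqb_spec k b) as [->|]; simpl; auto.
    destruct (Nat.ltb_spec b 5); [auto|lia].
  - apply Hs.
Qed.

(** The parameter is the first free register. A loop copies its count there and compiles its body
    with the next one, so the body may change [r] without changing the number of rounds. Bits 5 and
    6 are the marks of registers 0 and 1: tested in the cell of [r], they tell whether [r] is zero
    or at the limit. A zero register leaves the head in cell 0, so [Dec] then has nothing to do. *)
Fixpoint compile (nr : nat) (c : cmd) : tprog :=
  match c with
  | Skip => TSkip
  | Inc r => TSeq (goto r) (TIf (fun a => Nat.testbit a 6) home (TSeq home (move_mark r TR)))
  | Dec r => TSeq (goto r) (TIf (fun a => Nat.testbit a 5) TSkip (TSeq home (move_mark r TL)))
  | Copy r t => move_mark t (TSeq home (goto r))
  | Extend => move_mark 1 TR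
  | SetB r b => TSeq (goto r) (TSeq (set_bit b) home)
  | Seq c d => TSeq (compile nr c) (compile nr d)
  | IfEq r r' c d => TSeq (goto r) (TIf (fun a => Nat.testbit a (5 + r'))
      (TSeq home (compile nr c)) (TSeq home (compile nr d)))
  | IfB r b c d => TSeq (goto r) (TIf (fun a => Nat.testbit a b)
      (TSeq home (compile nr c)) (TSeq home (compile nr d)))
  | Loop r c =>
      TSeq (move_mark nr (TSeq home (goto r)))
        (TWhile (fun a => negb (Nat.testbit a (5 + nr)))
          (TSeq (move_mark nr TL) (compile (S nr) c)))
  end.

(** [V] bounds all registers, hence loop counts and lengths of head trips. The term 20 * (V + 1)
    pays for any primitive, which makes a few trips at three steps per cell. *)
Fixpoint cost (c : cmd) (V : nat) : nat :=
  match c with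
  | Skip => 0
  | Seq c d => cost c V + cost d V
  | IfEq _ _ c d | IfB _ _ c d => 20 * (V + 1) + cost c V + cost d V
  | Loop _ c => 20 * (V + 1) + 1 + V * (20 * (V + 1) + 2 + cost c V)
  | _ => 20 * (V + 1)
  end.

Lemma cost_polynomial c : exists C k, forall V, cost c V <= C * (V + 1) ^ k.
Proof.
  assert (Hadd : forall g h : nat -> nat, (exists C k, forall V, g V <= C * (V + 1) ^ k) ->
    (exists C k, forall V, h V <= C * (V + 1) ^ k) ->
    exists C k, forall V, g V + h V <= C * (V + 1) ^ k).
  { intros g h (C & k & Hg) (D & l & Hh).
    exists (C + D), (k + l); intros V; specialize (Hg V); specialize (Hh V).
    rewrite Nat.pow_add_r.
    pose proof (Nat.pow_nonzero (V + 1) k ltac:(lia)).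
    pose proof (Nat.pow_nonzero (V + 1) l ltac:(lia)).
    set (X := (V + 1) ^ k) in *; set (Y := (V + 1) ^ l) in *. nia. }
  assert (Hmul : forall g : nat -> nat, (exists C k, forall V, g V <= C * (V + 1) ^ k) ->
    exists C k, forall V, V * g V <= C * (V + 1) ^ k).
  { intros g (C & k & Hg).
    exists C, (S k); intros V; specialize (Hg V). simpl Nat.pow.
    set (X := (V + 1) ^ k) in *. nia. }
  assert (H20 : exists C k, forall V, 20 * (V + 1) <= C * (V + 1) ^ k)
    by (exists 20, 1; intros; rewrite Nat.pow_1_r; lia).
  assert (Hc : forall a, exists C k, forall V : nat, a <= C * (V + 1) ^ k)
    by (intros a; exists a, 0; intros; simpl; lia).
  induction c; cbn [cost]; auto.
Qed.

Lemma ev_if ns nt s f r (g : nat -> bool) a b f' p' t : on_tape nt s f -> r < nt -> 0 < nt ->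
  rg s 0 = 0 -> ev ns (if g (f (rg s r)) then a else b) f 0 f' p' t ->
  ev ns (TSeq (goto r) (TIf g (TSeq home a) (TSeq home b))) f 0 f' p' (6 * rg s r + 4 + t).
Proof.
  intros Hs Hr Hnt H0 Hev.
  assert (Hhome : ev ns home f (rg s r) f 0 (3 * rg s r + 1)).
  { apply ev_home; intros q; etransitivity; [exact (on_tape_reg nt s f q 0 Hs Hnt)|].
    now rewrite H0. }
  eapply ev_time; [|eapply ev_seq].
  2:{ apply (ev_goto _ f r (rg s r)); [|lia]. intros q; apply (on_tape_reg nt); auto. }
  2:{ destruct (g (f (rg s r))) eqn:E.
      - apply ev_if_true; [exact E|]. eapply ev_seq; [exact Hhome|exact Hev].
      - apply ev_if_false; [exact E|]. eapply ev_seq; [exact Hhome|exact Hev]. }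
  lia.
Qed.

Lemma ev_copy_mark nt s f r t : on_tape nt s f -> r < nt -> 0 < t < nt -> r <> t -> rg s 0 = 0 ->
  exists f' u, ev (2 ^ (5 + nt)) (move_mark t (TSeq home (goto r))) f 0 f' 0 u /\
    on_tape nt (rset s t (rg s r)) f' /\ u = 6 * rg s r + 6 * rg s t + 6.
Proof.
  intros Hs Hr Ht Hrt H0.
  destruct (ev_move_mark nt s f t (TSeq home (goto r)) (rg s r)
    (3 * rg s t + 1 + (3 * (rg s r - 0) + 1)) Hs Ht H0) as (f' & u & H1 & H2 & H3).
  - intros f1.
    assert (Hbit : forall q i, i < nt -> i <> t -> Nat.testbit (f1 q) (5 + i) = (rg s i =? q)).
    { intros q i Hi Hit; rewrite <- (on_tape_reg nt s f q i Hs Hi); unfold f1, upd.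
      destruct (Nat.eqb_spec q (rg s t)) as [->|]; auto.
      rewrite Nat.clearbit_eqb. destruct (Nat.eqb_spec (5 + t) (5 + i)); [lia|].
      apply andb_true_r. }
    apply ev_seq with (f1 := f1) (p1 := 0).
    + apply ev_home; intros q; etransitivity; [exact (Hbit q 0 ltac:(lia) ltac:(lia))|].
      now rewrite H0.
    + apply ev_goto; [|lia]. intros q; apply Hbit; auto.
  - exists f', u; repeat split; auto. lia.
Qed.

Lemma ev_dec_mark nt s f r : on_tape nt s f -> 0 < r < nt -> rg s 0 = 0 -> rg s r <> 0 ->
  exists f' u, ev (2 ^ (5 + nt)) (move_mark r TL) f 0 f' 0 u /\
    on_tape nt (rset s r (pred (rg s r))) f' /\ u <= 6 * rg s r + 5.
Proof.
  intros Hs Hr H0 Hpos.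
  destruct (ev_move_mark nt s f r TL (pred (rg s r)) 1 Hs Hr H0) as (f' & u & H1 & H2 & H3).
  - intros f1. destruct (rg s r) as [|k]; [congruence|]. apply ev_left.
  - exists f', u; repeat split; auto. lia.
Qed.

Lemma ev_inc_mark nt s f r : on_tape nt s f -> 0 < r < nt -> rg s 0 = 0 ->
  exists f' u, ev (2 ^ (5 + nt)) (move_mark r TR) f 0 f' 0 u /\
    on_tape nt (rset s r (S (rg s r))) f' /\ u <= 6 * rg s r + 8.
Proof.
  intros Hs Hr H0.
  destruct (ev_move_mark nt s f r TR (S (rg s r)) 1 Hs Hr H0) as (f' & u & H1 & H2 & H3).
  - intros f1. apply ev_right.
  - exists f', u; repeat split; auto. lia.
Qed.

(** The tape state [s] carries the counter in register [n], while the reference run starts from [s0]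
    without it; the two are compared below [n] only. *)
Lemma compile_loop nr nt V c :
  2 <= nr -> forall n, nr <= n < nt -> cmd_wf nr c = true ->
  (forall s f, on_tape nt s f -> limited s -> rg (exec c s) 1 <= V ->
    exists s' f' t, ev (2 ^ (5 + nt)) (compile (S n) c) f 0 f' 0 t /\ on_tape nt s' f' /\
      limited s' /\ eqv (S n) s' (exec c s) /\ t <= cost c V) ->
  forall k s0 s f, rg s n = k -> on_tape nt s f -> limited s -> eqv n s s0 ->
  rg (Nat.iter k (exec c) s0) 1 <= V ->
  exists s' f' t, ev (2 ^ (5 + nt)) (TWhile (fun a => negb (Nat.testbit a (5 + n)))
      (TSeq (move_mark n TL) (compile (S n) c))) f 0 f' 0 t /\ on_tape nt s' f' /\
    limited s' /\ eqv n s' (Nat.iter k (exec c) s0) /\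
    t <= k * (20 * (V + 1) + 2 + cost c V) + 1.
Proof.
  intros Hnr n Hn Hwf IH; induction k as [|k IHk]; intros s0 s f Hk Hs Hlim He HV.
  - exists s, f, 1; repeat split; auto; try apply Hlim; try apply He; try lia.
    apply ev_while_false. rewrite (on_tape_reg nt s f 0 n Hs), Hk by lia. reflexivity.
  - assert (Hk0 : rg s n <> 0) by lia.
    destruct (ev_dec_mark nt s f n Hs ltac:(lia) (proj1 Hlim) Hk0) as (f1 & u1 & E1 & T1 & U1).
    set (s1 := rset s n (pred (rg s n))) in *.
    assert (He1 : eqv n s1 s0).
    { eapply eqv_trans; [apply eqv_rset_above; auto|exact He]. }
    assert (Hlim1 : limited s1).
    { destruct Hlim as [L0 L1]; split; unfold s1; cbn [rset rg].
      - destruct (Nat.eqb_spec 0 n); [lia|auto].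
      - intros i; pose proof (L1 n). destruct (Nat.eqb_spec 1 n), (Nat.eqb_spec i n); auto; lia. }
    rewrite Nat.iter_succ_r in HV.
    assert (Hmono : forall j t, limited t -> limited (Nat.iter j (exec c) t) /\
      rg t 1 <= rg (Nat.iter j (exec c) t) 1).
    { induction j as [|j IHj]; intros t Ht; simpl; [auto|].
      destruct (IHj t Ht) as [J1 J2]. destruct (exec_limited nr c Hnr Hwf _ J1); split; auto; lia. }
    assert (Hec : eqv n (exec c s1) (exec c s0)) by (apply (exec_eqv nr); auto; lia).
    destruct (exec_limited nr c Hnr Hwf s1 Hlim1) as [Hlc _].
    (* The bound is given for the limit after all rounds; by monotonicity it holds after the current
       one. *)
    assert (HV1 : rg (exec c s1) 1 <= V).
    { pose proof (iter_eqv n (exec c) (fun a b => exec_eqv nr n c Hnr (proj1 Hn) Hwf a b) k _ _ Hec)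
        as [Hi _].
      destruct (Hmono k (exec c s1) Hlc) as [_ J].
      rewrite Hi in J by lia. lia. }
    destruct (IH s1 f1 T1 Hlim1 HV1) as (s2 & f2 & u2 & E2 & T2 & L2 & Q2 & U2).
    assert (Hk2 : rg s2 n = k).
    { rewrite (proj1 Q2) by lia. rewrite (exec_frame nr c Hnr Hwf) by lia.
      unfold s1; simpl; rewrite Nat.eqb_refl. lia. }
    destruct (IHk (exec c s0) s2 f2 Hk2 T2 L2) as (s3 & f3 & u3 & E3 & T3 & L3 & Q3 & U3).
    { eapply eqv_trans; [eapply eqv_le; [|exact Q2]; lia|exact Hec]. }
    { exact HV. }
    exists s3, f3; eexists; split; [|split; [exact T3|split; [exact L3|split]]].
    + eapply ev_while_true; [|eapply ev_seq; [exact E1|exact E2]|exact E3].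
      rewrite (on_tape_reg nt s f 0 n Hs) by lia.
      destruct (Nat.eqb_spec (rg s n) 0); [lia|auto].
    + rewrite Nat.iter_succ_r; exact Q3.
    + assert (rg s n <= V).
      { destruct Hlim as [_ L]; specialize (L n).
        destruct (exec_limited nr c Hnr Hwf s1 Hlim1) as [_ J].
        unfold s1 in J at 1; cbn [rset rg] in J. destruct (Nat.eqb_spec 1 n); lia. }
      simpl Nat.mul. lia.
Qed.

(** The number [nt] of marks, and with it the alphabet, is fixed for the whole program; n + depth c
    <= nt leaves one counter for each level of nested loops. *)
Lemma compile_correct nr nt V : 2 <= nr -> forall c n, cmd_wf nr c = true -> nr <= n ->
  n + depth c <= nt -> forall s f, on_tape nt s f -> limited s -> rg (exec c s) 1 <= V ->
  exists s' f' t, ev (2 ^ (5 + nt)) (compile n c) f 0 f' 0 t /\ on_tape nt s' f' /\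
    limited s' /\ eqv n s' (exec c s) /\ t <= cost c V.
Proof.
  intros Hnr; induction c as [|r|r|r t| |r b|c IHc d IHd|r r' c IHc d IHd|r b c IHc d IHd|r c IHc];
    intros n Hwf Hn Hnt s f Hs Hlim HV; cbn [depth] in Hnt;
    pose proof (exec_limited nr _ Hnr Hwf s Hlim) as [Hlim' Hmono];
    split_wf Hwf; cbn [compile cost]; pose proof Hlim as [Hz Hle].
  - exists s, f, 0; repeat split; auto. apply ev_skip.
  - assert (Hhome : forall p, ev (2 ^ (5 + nt)) home f p f 0 (3 * p + 1)).
    { intros p; apply ev_home; intros q; etransitivity;
        [exact (on_tape_reg nt s f q 0 Hs ltac:(lia))|]. now rewrite Hz. }
    pose proof (on_tape_reg nt s f (rg s r) 1 Hs ltac:(lia)) as Hbit; simpl Nat.add in Hbit.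
    cbn [exec] in *. rewrite (Nat.eqb_sym (rg s r)) in *. specialize (Hle r).
    destruct (Nat.eqb_spec (rg s 1) (rg s r)) as [E|E].
    + exists s, f; eexists; split; [|split; [exact Hs|split; [exact Hlim|split; [apply eqv_refl|]]]].
      * eapply ev_seq; [apply (ev_goto _ f r (rg s r)); [|lia]|apply ev_if_true; [exact Hbit|apply Hhome]].
        intros q; apply (on_tape_reg nt); auto; lia.
      * lia.
    + destruct (ev_inc_mark nt s f r Hs ltac:(lia) Hz) as (f1 & u & E1 & T1 & U1).
      exists (rset s r (S (rg s r))), f1; eexists; split; [|split; [exact T1|split; [exact Hlim'|split; [apply eqv_refl|]]]].
      * eapply ev_seq; [apply (ev_goto _ f r (rg s r)); [|lia]|apply ev_if_false; [exact Hbit|]].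
        { intros q; apply (on_tape_reg nt); auto; lia. }
        eapply ev_seq; [apply Hhome|exact E1].
      * lia.
  - assert (Hhome : forall p, ev (2 ^ (5 + nt)) home f p f 0 (3 * p + 1)).
    { intros p; apply ev_home; intros q; etransitivity;
        [exact (on_tape_reg nt s f q 0 Hs ltac:(lia))|]. now rewrite Hz. }
    pose proof (on_tape_reg nt s f (rg s r) 0 Hs ltac:(lia)) as Hbit; simpl Nat.add in Hbit.
    cbn [exec] in *. specialize (Hle r). rewrite Hz in Hbit.
    destruct (Nat.eqb_spec 0 (rg s r)) as [E|E].
    + exists s, f; eexists; split; [|split; [exact Hs|split; [exact Hlim|split]]].
      * eapply ev_seq; [apply (ev_goto _ f r (rg s r)); [|lia]|apply ev_if_true; [exact Hbit|]].
        { intros q; apply (on_tape_reg nt); auto; lia. }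
        rewrite <- E; apply ev_skip.
      * split; simpl; auto. intros i Hi; destruct (Nat.eqb_spec i r); [subst i; lia|auto].
      * lia.
    + destruct (ev_dec_mark nt s f r Hs ltac:(lia) Hz ltac:(lia)) as (f1 & u & E1 & T1 & U1).
      exists (rset s r (pred (rg s r))), f1; eexists; split; [|split; [exact T1|split; [exact Hlim'|split; [apply eqv_refl|]]]].
      * eapply ev_seq; [apply (ev_goto _ f r (rg s r)); [|lia]|apply ev_if_false; [exact Hbit|]].
        { intros q; apply (on_tape_reg nt); auto; lia. }
        eapply ev_seq; [apply Hhome|exact E1].
      * lia.
  - match goal with X : negb _ = true |- _ => apply negb_true_iff, Nat.eqb_neq in X end.
    destruct (ev_copy_mark nt s f r t Hs ltac:(lia) ltac:(lia) ltac:(auto) Hz) as (f1 & u & E1 & T1 & U1).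
    pose proof (Hle r); pose proof (Hle t).
    exists (rset s t (rg s r)), f1, u; split; [exact E1|split; [exact T1|split; [exact Hlim'|split; [apply eqv_refl|]]]].
    lia.
  - destruct (ev_inc_mark nt s f 1 Hs ltac:(lia) Hz) as (f1 & u & E1 & T1 & U1).
    exists (rset s 1 (S (rg s 1))), f1, u; split; [exact E1|split; [exact T1|split; [exact Hlim'|split; [apply eqv_refl|]]]].
    simpl in HV. lia.
  - pose proof (on_tape_mset nt s f (rg s r) b Hs ltac:(auto)) as T1.
    specialize (Hle r).
    eexists _, _, _; split; [|split; [exact T1|split; [exact Hlim'|split; [apply eqv_refl|]]]].
    + eapply ev_seq.
      { apply (ev_goto _ f r (rg s r)); [|lia]. intros q; apply (on_tape_reg nt); auto; lia. }
      eapply ev_seq.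
      { apply (ev_upd _ (fun c => Nat.setbit c b)).
        apply lt_pow2_of_bits; intros k Hk. rewrite Nat.setbit_eqb, (on_tape_high nt s) by auto.
        destruct (Nat.eqb_spec b k); [lia|auto]. }
      apply ev_home; intros q; etransitivity; [exact (on_tape_reg nt _ _ q 0 T1 ltac:(lia))|].
      cbn [mset rg]. now rewrite Hz.
    + lia.
  - cbn [exec] in *.
    destruct (exec_limited nr d Hnr ltac:(auto) _ (proj1 (exec_limited nr c Hnr Hwf s Hlim))) as [_ J].
    destruct (IHc n Hwf Hn ltac:(lia) s f Hs Hlim ltac:(lia)) as (s1 & f1 & u1 & E1 & T1 & L1 & Q1 & U1).
    pose proof (exec_eqv nr n d Hnr Hn ltac:(auto) _ _ Q1) as Q.
    destruct (IHd n ltac:(auto) Hn ltac:(lia) s1 f1 T1 L1) as (s2 & f2 & u2 & E2 & T2 & L2 & Q2 & U2).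
    { rewrite (proj1 Q) by lia; auto. }
    exists s2, f2; eexists; split; [eapply ev_seq; eauto|split; [exact T2|split; [exact L2|split]]].
    + eapply eqv_trans; eauto.
    + lia.
  - cbn [exec] in *. specialize (Hle r).
    pose proof (on_tape_reg nt s f (rg s r) r' Hs ltac:(lia)) as Hbit.
    rewrite (Nat.eqb_sym (rg s r)) in *.
    assert (HX : exists s' f' t, ev (2 ^ (5 + nt)) (if Nat.testbit (f (rg s r)) (5 + r')
        then compile n c else compile n d) f 0 f' 0 t /\ on_tape nt s' f' /\ limited s' /\
        eqv n s' (if rg s r' =? rg s r then exec c s else exec d s) /\ t <= cost c V + cost d V).
    { rewrite Hbit. destruct (rg s r' =? rg s r).
      - destruct (IHc n ltac:(auto) Hn ltac:(lia) s f Hs Hlim HV) as (s1 & f1 & u1 & E1 & T1 & L1 & Q1 & U1).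
        exists s1, f1, u1; repeat split; auto; try apply L1; try apply Q1; lia.
      - destruct (IHd n ltac:(auto) Hn ltac:(lia) s f Hs Hlim HV) as (s1 & f1 & u1 & E1 & T1 & L1 & Q1 & U1).
        exists s1, f1, u1; repeat split; auto; try apply L1; try apply Q1; lia. }
    destruct HX as (s1 & f1 & u1 & E1 & T1 & L1 & Q1 & U1).
    exists s1, f1; eexists; split; [|split; [exact T1|split; [exact L1|split; [exact Q1|]]]].
    + apply (ev_if _ nt s f r (fun a => Nat.testbit a (5 + r'))); auto; try lia. exact E1.
    + lia.
  - cbn [exec] in *. specialize (Hle r).
    pose proof (on_tape_mem nt s f (rg s r) b Hs ltac:(lia)) as Hbit.
    assert (HX : exists s' f' t, ev (2 ^ (5 + nt)) (if Nat.testbit (f (rg s r)) b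
        then compile n c else compile n d) f 0 f' 0 t /\ on_tape nt s' f' /\ limited s' /\
        eqv n s' (if mm s (rg s r) b then exec c s else exec d s) /\ t <= cost c V + cost d V).
    { rewrite Hbit. destruct (mm s (rg s r) b).
      - destruct (IHc n ltac:(auto) Hn ltac:(lia) s f Hs Hlim HV) as (s1 & f1 & u1 & E1 & T1 & L1 & Q1 & U1).
        exists s1, f1, u1; repeat split; auto; try apply L1; try apply Q1; lia.
      - destruct (IHd n ltac:(auto) Hn ltac:(lia) s f Hs Hlim HV) as (s1 & f1 & u1 & E1 & T1 & L1 & Q1 & U1).
        exists s1, f1, u1; repeat split; auto; try apply L1; try apply Q1; lia. }
    destruct HX as (s1 & f1 & u1 & E1 & T1 & L1 & Q1 & U1).
    exists s1, f1; eexists; split; [|split; [exact T1|split; [exact L1|split; [exact Q1|]]]].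
    + apply (ev_if _ nt s f r (fun a => Nat.testbit a b)); auto; try lia. exact E1.
    + lia.
  - cbn [exec] in *. pose proof (Hle r); pose proof (Hle n).
    destruct (ev_copy_mark nt s f r n Hs ltac:(lia) ltac:(lia) ltac:(lia) Hz) as (f1 & u & E1 & T1 & U1).
    destruct (compile_loop nr nt V c Hnr n ltac:(lia) ltac:(auto)) with (k := rg s r) (s0 := s)
      (s := rset s n (rg s r)) (f := f1) as (s2 & f2 & u2 & E2 & T2 & L2 & Q2 & U2); auto.
    { intros; apply IHc; auto; lia. }
    { simpl; now rewrite Nat.eqb_refl. }
    { split; cbn [rset rg].
      - destruct (Nat.eqb_spec 0 n); [lia|auto].
      - intros i; destruct (Nat.eqb_spec 1 n), (Nat.eqb_spec i n); auto; lia. }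
    { apply eqv_rset_above; auto. }
    exists s2, f2; eexists; split; [eapply ev_seq; eauto|split; [exact T2|split; [exact L2|split; [exact Q2|]]]].
    assert (rg s r <= V) by lia. nia.
Qed.

(** * From the input word to the first state, and the resulting machine *)

Definition init_state (input : list nat) : state :=
  mkState (fun i => if i =? 1 then length input else 0)
    (fun p b => Nat.testbit (nth p input 0) b).

Definition set_marks (rs : list nat) (a : nat) : nat :=
  fold_right (fun r a => Nat.setbit a (5 + r)) a rs.

Lemma set_marks_spec rs a b : Nat.testbit (set_marks rs a) b =
  existsb (fun r => 5 + r =? b) rs || Nat.testbit a b.
Proof.
  induction rs as [|r rs IH]; cbn [set_marks fold_right existsb]; auto.
  rewrite Nat.setbit_eqb. fold (set_marks rs a). rewrite IH. apply orb_assoc.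
Qed.

(** All registers except 1 start at 0, so their marks go into cell 0. The limit starts as the input
    length, found as the first blank cell: input symbols are nonzero, and cell 0 carries marks by
    then. Symbols use bits 0 to 2, so bits 3 and 4 start out empty and can hold the bitmap. *)
Definition start_up (nt : nat) : tprog :=
  TSeq (TUpd (set_marks (0 :: seq 2 (nt - 2))))
    (TSeq (TWhile (fun a => negb (a =? 0)) TR) (TSeq (set_bit 6) home)).

Lemma testbit_symbol a b : a <= 4 -> 3 <= b -> Nat.testbit a b = false.
Proof.
  intros Ha Hb. apply Nat.bits_above_log2.
  pose proof (Nat.log2_le_mono _ _ Ha) as H. change (Nat.log2 4) with 2 in H. lia.
Qed.

Lemma start_up_correct nt input : 2 <= nt -> input <> [] -> (forall a, In a input -> 1 <= a <= 4) ->
  exists f t, ev (2 ^ (5 + nt)) (start_up nt) (fun p => nth p input 0) 0 f 0 t /\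
    on_tape nt (init_state input) f /\ t <= 6 * length input + 4.
Proof.
  intros Hnt Hne Hin; set (tape := fun p => nth p input 0); set (n := length input).
  assert (Hn : 0 < n) by (destruct input; [congruence|unfold n; simpl; lia]).
  assert (Hsym : forall p, tape p <= 4).
  { intros p; unfold tape; destruct (nth_in_or_default p input 0) as [H| ->]; [|lia].
    now apply Hin. }
  set (rs := 0 :: seq 2 (nt - 2)).
  assert (Hrs : forall b, existsb (fun r => 5 + r =? b) rs = true <-> 5 <= b < 5 + nt /\ b <> 6).
  { intros b; rewrite existsb_exists; split.
    - intros (r & [<-|Hr] & Hb); apply Nat.eqb_eq in Hb; [lia|]. apply in_seq in Hr; lia.
    - intros [H1 H2]; exists (b - 5); split; [|apply Nat.eqb_eq; lia].
      destruct (Nat.eq_dec b 5) as [->|]; [left; auto|right; apply in_seq; lia]. }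
  set (f1 := upd tape 0 (set_marks rs (tape 0))).
  assert (H1 : forall p, f1 p <> 0 <-> p < n).
  { intros p; unfold f1, upd; destruct (Nat.eqb_spec p 0) as [->|Hp].
    - split; [auto|]. intros _ E.
      pose proof (set_marks_spec rs (tape 0) 5) as H. rewrite E, (proj2 (Hrs 5)) in H by lia.
      discriminate.
    - unfold tape; split; intros H.
      + destruct (Nat.lt_ge_cases p n); auto. rewrite nth_overflow in H by auto. congruence.
      + pose proof (Hin _ (nth_In input 0 H)). lia. }
  set (f2 := upd f1 n (Nat.setbit (f1 n) 6)).
  assert (Hw : forall k p, p + k = n ->
    ev (2 ^ (5 + nt)) (TWhile (fun a => negb (a =? 0)) TR) f1 p f1 n (3 * k + 1)).
  { induction k as [|k IH]; intros p Hp.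
    - replace p with n by lia. apply ev_while_false.
      destruct (Nat.eqb_spec (f1 n) 0) as [|E]; [auto|]. apply H1 in E; lia.
    - eapply ev_time; [|eapply ev_while_true; [|apply ev_right|apply IH]]; [lia| |lia].
      destruct (Nat.eqb_spec (f1 p) 0) as [E|]; [|auto]. apply H1 in E; [destruct E|lia]. }
  assert (Hf2 : on_tape nt (init_state input) f2).
  { intros p b; cbn [init_state rg mm]; fold (tape p); fold n.
    assert (Hf1 : Nat.testbit (f1 p) b = (if p =? 0 then existsb (fun r => 5 + r =? b) rs else false)
      || Nat.testbit (tape p) b).
    { unfold f1, upd; destruct (Nat.eqb_spec p 0) as [->|]; [apply set_marks_spec|auto]. }
    assert (H2 : Nat.testbit (f2 p) b = (if p =? n then 6 =? b else false) || Nat.testbit (f1 p) b).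
    { unfold f2, upd; destruct (Nat.eqb_spec p n) as [->|]; [apply Nat.setbit_eqb|auto]. }
    rewrite H2, Hf1; clear H2 Hf1.
    specialize (Hrs b). destruct (existsb _ rs) eqn:Ers.
    - destruct (proj1 Hrs eq_refl) as [Hb1 Hb2].
      rewrite (testbit_symbol (tape p) b) by (auto; lia).
      destruct (Nat.ltb_spec b 5); [lia|]; destruct (Nat.ltb_spec b (5 + nt)); [|lia].
      destruct (Nat.eqb_spec 6 b); [lia|]; destruct (Nat.eqb_spec (b - 5) 1); [lia|].
      rewrite (Nat.eqb_sym 0 p). destruct (p =? 0), (p =? n); reflexivity.
    - assert (Hb : ~ (5 <= b < 5 + nt /\ b <> 6)) by (rewrite <- Hrs; discriminate).
      destruct (Nat.ltb_spec b 5).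
      + destruct (Nat.eqb_spec 6 b); [lia|]. destruct (p =? n), (p =? 0); auto.
      + rewrite (testbit_symbol (tape p) b) by (auto; lia).
        destruct (Nat.ltb_spec b (5 + nt)).
        * assert (b = 6) by lia; subst b. simpl. rewrite (Nat.eqb_sym n p).
          destruct (p =? n), (p =? 0); auto.
        * destruct (Nat.eqb_spec 6 b); [lia|]. destruct (p =? n), (p =? 0); auto. }
  exists f2; eexists; split; [|split; [exact Hf2|]].
  - eapply ev_seq.
    { apply (ev_upd _ (set_marks rs)). apply lt_pow2_of_bits; intros b Hb.
      rewrite set_marks_spec, (testbit_symbol (tape 0)) by (auto; lia).
      destruct (existsb _ rs) eqn:E; auto. apply Hrs in E; lia. }
    eapply ev_seq; [apply (Hw n 0); lia|].
    eapply ev_seq.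
    { apply (ev_upd _ (fun a => Nat.setbit a 6)). apply lt_pow2_of_bits; intros b Hb.
      replace (Nat.setbit (f1 n) 6) with (f2 n) by (unfold f2, upd; now rewrite Nat.eqb_refl).
      now rewrite (on_tape_high nt _ _ _ _ Hf2). }
    apply ev_home; intros q; exact (on_tape_reg nt _ f2 q 0 Hf2 ltac:(lia)).
  - lia.
Qed.

Lemma init_state_limited input : limited (init_state input).
Proof.
  split; simpl; auto. intros i; destruct (i =? 1); lia.
Qed.

(** The head finishes in cell 0, whose symbol carries the mark of [out] exactly when that register
    is zero; [acc] reads this mark. *)
Theorem loop_machine nr c out : 2 <= nr -> out < nr -> cmd_wf nr c = true ->
  exists M, TM_wf M /\ exists C k, forall input, input <> [] -> (forall a, In a input -> 1 <= a <= 4) ->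
    let s := exec c (init_state input) in
    exists t, t <= C * (rg s 1 + 1) ^ k /\ halted M (run M t input) /\
      (cst (run M t input) = qacc M <-> rg s out <> 0).
Proof.
  intros Hnr Hout Hwf.
  assert (Hnt : exists nt, nr + depth c <= nt) by eauto. destruct Hnt as [nt Hnt].
  set (p := TSeq (start_up nt) (compile nr c)).
  set (ns := 2 ^ (5 + nt)).
  set (rows := assemble ns 0 p).
  set (acc := fun a => negb (Nat.testbit a (5 + out))).
  assert (Hns : 5 <= ns).
  { unfold ns; rewrite Nat.pow_add_r. pose proof (Nat.pow_nonzero 2 nt ltac:(lia)).
    change (2 ^ 5) with 32. lia. }
  assert (Hlen : length rows = tsize p) by apply length_assemble.
  exists (machine ns acc rows); split.
  { apply machine_wf; auto. rewrite Hlen. apply assemble_wf. auto. }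
  destruct (cost_polynomial c) as (C & k & HC).
  (* The additional 11 and the additional factor cover the start-up, at most 6 * length input + 4
     steps, and the final halting step. *)
  exists (C + 11), (S k); intros input Hne Hin s.
  pose proof (init_state_limited input) as Hlim.
  destruct (exec_limited nr c Hnr Hwf _ Hlim) as [_ Hmono]; fold s in Hmono.
  destruct (start_up_correct nt input ltac:(lia) Hne Hin) as (f1 & u1 & E1 & T1 & U1).
  destruct (compile_correct nr nt (rg s 1) Hnr c nr Hwf ltac:(auto) Hnt _ f1 T1 Hlim ltac:(auto))
    as (s2 & f2 & u2 & E2 & T2 & _ & Q2 & U2).
  fold s in Q2.
  destruct (machine_simulates ns acc rows p (fun q => nth q input 0) 0 f2 0 (u1 + u2)) with (base := 0)
    (cf := init (machine ns acc rows) input) as (t & Ht & Hshow).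
  { eapply ev_seq; eauto. }
  { intros i r Hi; exact Hi. }
  { destruct input as [|a r]; [congruence|]. repeat split; simpl; auto; lia. }
  rewrite Nat.add_0_l, <- Hlen in Hshow.
  assert (Hd : delta (machine ns acc rows) (length rows) (f2 0) =
    (if acc (f2 0) then length rows + 1 else length rows + 2, f2 0, Stay)).
  { cbn [machine delta].
    now rewrite (proj2 (nth_error_None rows (length rows)) (le_n _)). }
  pose proof (step_stay _ _ _ _ _ _ _ _ _ Hshow (le_n _) Hd) as (Hq & _).
  exists (S t); unfold run; simpl Nat.iter; split; [|split].
  - specialize (HC (rg s 1)). simpl in Hmono. simpl Nat.pow.
    pose proof (Nat.pow_nonzero (rg s 1 + 1) k ltac:(lia)).
    assert (rg s 1 + 1 <= (rg s 1 + 1) * (rg s 1 + 1) ^ k) by nia.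
    assert (C * (rg s 1 + 1) ^ k <= C * ((rg s 1 + 1) * (rg s 1 + 1) ^ k)) by nia.
    nia.
  - unfold halted. rewrite Hq. simpl. destruct (acc (f2 0)); auto.
  - rewrite Hq. unfold acc. rewrite (on_tape_reg nt s2 f2 0 out T2) by lia.
    rewrite (proj1 Q2) by lia. cbn [machine qacc].
    destruct (Nat.eqb_spec (rg s out) 0); simpl; split; intros; lia.
Qed.

(** * The decision procedure as a loop program *)

Lemma state_ext s s' : (forall i, rg s i = rg s' i) -> mm s = mm s' -> s = s'.
Proof.
  destruct s, s'; simpl; intros H ->; f_equal; now apply functional_extensionality.
Qed.

Ltac state_eq := apply state_ext; [intros i; cbn [rset mset rg]; repeat
  match goal with |- context [i =? ?r] => destruct (Nat.eqb_spec i r); [try subst i|] end;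
  simpl; try lia; auto | reflexivity].

Lemma exec_Seq c d s : exec (Seq c d) s = exec d (exec c s).
Proof. reflexivity. Qed.

Lemma exec_IfB r b c d s :
  exec (IfB r b c d) s = if mm s (rg s r) b then exec c s else exec d s.
Proof. reflexivity. Qed.

Lemma exec_IfEq r r' c d s :
  exec (IfEq r r' c d) s = if rg s r =? rg s r' then exec c s else exec d s.
Proof. reflexivity. Qed.

Lemma exec_Copy r t s : exec (Copy r t) s = rset s t (rg s r).
Proof. reflexivity. Qed.

Lemma exec_Inc r s : exec (Inc r) s = if rg s r =? rg s 1 then s else rset s r (S (rg s r)).
Proof. reflexivity. Qed.

Lemma exec_Loop r c s : exec (Loop r c) s = Nat.iter (rg s r) (exec c) s.
Proof. reflexivity. Qed.

Lemma exec_Skip s : exec Skip s = s.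
Proof. reflexivity. Qed.

Lemma exec_SetB r b s : exec (SetB r b) s = mset s (rg s r) b.
Proof. reflexivity. Qed.

Ltac numeral n := match n with O => idtac | S ?m => numeral m end.

Ltac regs := cbn [rset mset rg mm]; repeat
  match goal with |- context [?a =? ?b] =>
    numeral a; numeral b; let c := eval compute in (a =? b) in change (a =? b) with c
  end; cbn iota.

Lemma loop_invariant (P : nat -> state -> Prop) (g : state -> state) n s :
  P 0 s -> (forall i t, i < n -> P i t -> P (S i) (g t)) -> P n (Nat.iter n g s).
Proof.
  intros H0 Hstep.
  enough (H : forall i, i <= n -> P i (Nat.iter i g s)) by (apply H; auto).
  induction i as [|i IH]; intros Hi; simpl; auto. apply Hstep; auto; apply IH; lia.
Qed.

(** Increments stop at the limit, so sums and products come out truncated there; a register that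
    equals the limit thus signals a possible overflow. *)
Lemma exec_add r t s : 2 <= t -> rg s t <= rg s 1 ->
  exec (Loop r (Inc t)) s = rset s t (Nat.min (rg s 1) (rg s t + rg s r)).
Proof.
  intros Ht Hle; cbn [exec].
  assert (H : forall n, Nat.iter n (exec (Inc t)) s = rset s t (Nat.min (rg s 1) (rg s t + n))).
  { induction n as [|n IH]; [simpl; state_eq|].
    rewrite Nat.iter_succ, IH; cbn [exec rset rg].
    rewrite Nat.eqb_refl. destruct (Nat.eqb_spec 1 t); [lia|].
    destruct (Nat.eqb_spec (Nat.min (rg s 1) (rg s t + n)) (rg s 1)); state_eq. }
  apply H.
Qed.

Lemma exec_sub r t s : exec (Loop r (Dec t)) s = rset s t (rg s t - rg s r).
Proof.
  cbn [exec].
  assert (H : forall n, Nat.iter n (exec (Dec t)) s = rset s t (rg s t - n)).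
  { induction n as [|n IH]; [simpl; state_eq|].
    rewrite Nat.iter_succ, IH; cbn [exec rset rg].
    rewrite Nat.eqb_refl. state_eq. }
  apply H.
Qed.

Lemma exec_mul r r' t s : 2 <= t -> r <> t -> r' <> t -> rg s t <= rg s 1 ->
  exec (Loop r (Loop r' (Inc t))) s = rset s t (Nat.min (rg s 1) (rg s t + rg s r * rg s r')).
Proof.
  intros Ht Hr Hr' Hle; cbn [exec].
  assert (H : forall n, Nat.iter n (exec (Loop r' (Inc t))) s =
    rset s t (Nat.min (rg s 1) (rg s t + n * rg s r'))).
  { induction n as [|n IH]; [simpl; state_eq|].
    rewrite Nat.iter_succ, IH, exec_add; auto; cbn [rset rg].
    - rewrite Nat.eqb_refl. destruct (Nat.eqb_spec 1 t), (Nat.eqb_spec r' t); try lia.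
      simpl Nat.mul. state_eq.
    - rewrite Nat.eqb_refl. destruct (Nat.eqb_spec 1 t); lia. }
  apply H.
Qed.

(** * Parsing *)

(** Symbol 3, the end of a number, is the one with bits 0 and 1 both set. The step is idle there, so
    it may safely be repeated as often as the limit says. [Loop 6 (Inc 6)] doubles the weight. *)
Definition bit_step : cmd :=
  IfB 4 1
    (IfB 4 0 Skip (Seq (Loop 6 (Inc 5)) (Seq (Loop 6 (Inc 6)) (Inc 4))))
    (Seq (Loop 6 (Inc 6)) (Inc 4)).

(* Registers: 4 input pointer, 5 and 7 magnitude and sign (1 if negative) of the integer just read,
   6 weight of the current bit, 8 and 9 magnitude and sign of the slope, 10 start of the list of
   functions, 11 scanned cell, 12 to 14 image, 15 answer, 2, 3 and 16 used only to set the limit. *)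
Definition parse : cmd :=
  Seq (Copy 0 5) (Seq (Copy 0 6) (Seq (Inc 6) (Seq (Copy 0 7)
    (Seq (IfB 4 2 (Seq (Inc 7) (Inc 4)) Skip) (Seq (Loop 1 bit_step) (Inc 4)))))).

(** Only bits below 3 are compared, so what is known about the input is not affected by marks in
    layers 3 and 4. *)
Definition holds (m : nat -> nat -> bool) (p : nat) (l : list nat) : Prop :=
  forall i b, i < length l -> b < 3 -> m (p + i) b = Nat.testbit (nth i l 0) b.

Lemma holds_app m p l l' : holds m p (l ++ l') <-> holds m p l /\ holds m (p + length l) l'.
Proof.
  split.
  - intros H; split; intros i b Hi Hb.
    + rewrite H, app_nth1; auto. rewrite length_app; lia.
    + rewrite <- Nat.add_assoc, H; auto; [|rewrite length_app; lia].
      rewrite app_nth2 by lia. do 2 f_equal; lia.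
  - intros [H1 H2] i b Hi Hb. rewrite length_app in Hi.
    destruct (Nat.lt_ge_cases i (length l)).
    + rewrite app_nth1 by auto. apply H1; auto.
    + rewrite app_nth2 by auto. rewrite <- H2; auto; [f_equal; lia|lia].
Qed.

Lemma holds_head m p a l b : holds m p (a :: l) -> b < 3 -> m p b = Nat.testbit a b.
Proof. intros H Hb. rewrite <- (Nat.add_0_r p). apply (H 0); simpl; auto; lia. Qed.

Lemma holds_tail m p a l : holds m p (a :: l) -> holds m (S p) l.
Proof. intros H i b Hi Hb. rewrite Nat.add_succ_comm. apply (H (S i)); simpl; auto; lia. Qed.

Lemma pos_lt_pow2_bits q : Pos.to_nat q < 2 ^ length (pos_bits q).
Proof.
  induction q; cbn [pos_bits length Nat.pow]; rewrite ?Pos2Nat.inj_xI, ?Pos2Nat.inj_xO; lia.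
Qed.

Lemma bit_step_stop k s : mm s (rg s 4) 1 = true -> mm s (rg s 4) 0 = true ->
  Nat.iter k (exec bit_step) s = s.
Proof.
  intros H1 H0; induction k as [|k IH]; auto.
  rewrite Nat.iter_succ, IH; cbn [exec bit_step]. now rewrite H1, H0.
Qed.

Lemma parse_bits q : forall k s, holds (mm s) (rg s 4) (pos_bits q ++ [3]) ->
  length (pos_bits q) <= k -> rg s 4 + length (pos_bits q) <= rg s 1 ->
  rg s 5 + rg s 6 * Pos.to_nat q <= rg s 1 -> rg s 6 * 2 ^ length (pos_bits q) <= rg s 1 ->
  Nat.iter k (exec bit_step) s =
    rset (rset (rset s 4 (rg s 4 + length (pos_bits q))) 5 (rg s 5 + rg s 6 * Pos.to_nat q))
      6 (rg s 6 * 2 ^ length (pos_bits q)).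
Proof.
  assert (Hone : forall l s, holds (mm s) (rg s 4) (2 :: l) -> rg s 4 < rg s 1 ->
    rg s 5 + rg s 6 <= rg s 1 -> 2 * rg s 6 <= rg s 1 ->
    exec bit_step s = rset (rset (rset s 5 (rg s 5 + rg s 6)) 6 (2 * rg s 6)) 4 (S (rg s 4))).
  { intros l s Hh Hp Hv Hw; unfold bit_step; rewrite !exec_IfB.
    rewrite !(holds_head _ _ _ _ _ Hh) by lia; cbn [Nat.testbit Nat.odd Nat.even negb Nat.div2].
    rewrite !exec_Seq, (exec_add 6 5) by lia. rewrite (exec_add 6 6) by (regs; lia).
    rewrite exec_Inc; regs.
    destruct (Nat.eqb_spec (rg s 4) (rg s 1)); [lia|]. state_eq. }
  assert (Hzero : forall l s, holds (mm s) (rg s 4) (1 :: l) -> rg s 4 < rg s 1 ->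
    2 * rg s 6 <= rg s 1 ->
    exec bit_step s = rset (rset s 6 (2 * rg s 6)) 4 (S (rg s 4))).
  { intros l s Hh Hp Hv; unfold bit_step; rewrite !exec_IfB.
    rewrite !(holds_head _ _ _ _ _ Hh) by lia; cbn [Nat.testbit Nat.odd Nat.even negb Nat.div2].
    rewrite !exec_Seq, exec_add by lia.
    rewrite exec_Inc; regs.
    destruct (Nat.eqb_spec (rg s 4) (rg s 1)); [lia|]. state_eq. }
  induction q as [q IH|q IH|]; intros k s Hh Hk Hp Hv Hw; cbn [pos_bits length app Nat.pow] in *;
    (destruct k as [|k]; [lia|]); rewrite Nat.iter_succ_r.
  - pose proof (Nat.pow_nonzero 2 (length (pos_bits q)) ltac:(lia)).
    rewrite Pos2Nat.inj_xI in *; pose proof (Pos2Nat.is_pos q).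
    rewrite (Hone _ _ Hh) by nia.
    rewrite IH; regs; try lia.
    + state_eq.
    + exact (holds_tail _ _ _ _ Hh).
  - pose proof (Nat.pow_nonzero 2 (length (pos_bits q)) ltac:(lia)).
    rewrite Pos2Nat.inj_xO in *; pose proof (Pos2Nat.is_pos q).
    rewrite (Hzero _ _ Hh) by nia.
    rewrite IH; regs; try lia.
    + state_eq.
    + exact (holds_tail _ _ _ _ Hh).
  - simpl Nat.pow in Hw. change (Pos.to_nat 1) with 1 in *. rewrite (Hone _ _ Hh) by lia.
    pose proof (holds_tail _ _ _ _ Hh) as Ht.
    rewrite bit_step_stop; regs.
    + simpl Nat.pow. state_eq.
    + exact (holds_head _ _ _ _ 1 Ht ltac:(lia)).
    + exact (holds_head _ _ _ _ 0 Ht ltac:(lia)).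
Qed.

Definition sign_nat (z : Z) : nat := if (z <? 0)%Z then 1 else 0.

(** The two size conditions guarantee that pointer, value and weight are never truncated. The final
    weight [w] is left unspecified. *)
Lemma parse_spec z s : rg s 0 = 0 -> holds (mm s) (rg s 4) (enc_Z z) ->
  rg s 4 + length (enc_Z z) <= rg s 1 -> 2 ^ length (enc_Z z) <= rg s 1 ->
  exists w, exec parse s =
    rset (rset (rset (rset s 5 (Z.abs_nat z)) 6 w) 7 (sign_nat z)) 4 (rg s 4 + length (enc_Z z)).
Proof.
  intros Hz Hh Hp Hw; unfold parse; rewrite !exec_Seq.
  set (s0 := rset (rset (rset s 5 0) 6 1) 7 0).
  pose proof (Nat.pow_nonzero 2 (length (enc_Z z)) ltac:(lia)) as Hpow.
  replace (exec (Copy 0 7) (exec (Inc 6) (exec (Copy 0 6) (exec (Copy 0 5) s)))) with s0.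
  2:{ rewrite !exec_Copy, exec_Inc; regs; rewrite !Hz.
      destruct (Nat.eqb_spec 0 (rg s 1)); [lia|]. unfold s0; regs; rewrite ?Hz; state_eq. }
  rewrite exec_IfB, exec_Loop, exec_Skip, exec_Inc.
  change (mm s0 (rg s0 4) 2) with (mm s (rg s 4) 2).
  destruct z as [|q|q]; cbn [enc_Z] in *.
  - assert (Hb : mm s (rg s 4) 2 = false) by exact (holds_head _ _ _ _ 2 Hh ltac:(lia)).
    rewrite Hb, bit_step_stop; unfold s0; regs.
    + exists 1. simpl length in *. destruct (Nat.eqb_spec (rg s 4) (rg s 1)); [lia|].
      unfold sign_nat; simpl. state_eq.
    + exact (holds_head _ _ _ _ 1 Hh ltac:(lia)).
    + exact (holds_head _ _ _ _ 0 Hh ltac:(lia)).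
  - assert (Hb : mm s (rg s 4) 2 = false).
    { destruct q; exact (holds_head _ _ _ _ 2 Hh ltac:(lia)). }
    rewrite length_app in *; simpl length in *. rewrite Hb.
    rewrite parse_bits with (q := q); unfold s0; regs; try lia; auto.
    + exists (2 ^ length (pos_bits q)). destruct (Nat.eqb_spec (rg s 4 + length (pos_bits q)) (rg s 1)); [lia|].
      change (sign_nat (Z.pos q)) with 0. simpl Z.abs_nat. state_eq.
    + rewrite Nat.pow_add_r in Hw. pose proof (pos_lt_pow2_bits q). simpl in Hw. lia.
    + rewrite Nat.pow_add_r in Hw. simpl in Hw. lia.
  - assert (Hb : mm s (rg s 4) 2 = true) by exact (holds_head _ _ _ _ 2 Hh ltac:(lia)).
    simpl length in *; rewrite length_app in *; simpl length in *.
    assert (E : exec (Seq (Inc 7) (Inc 4)) s0 = rset (rset s0 7 1) 4 (S (rg s 4))).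
    { rewrite exec_Seq, (exec_Inc 7); unfold s0; regs.
      destruct (Nat.eqb_spec 0 (rg s 1)); [lia|]. rewrite exec_Inc; regs.
      destruct (Nat.eqb_spec (rg s 4) (rg s 1)); [lia|]. reflexivity. }
    rewrite Hb, E; unfold s0; regs.
    rewrite parse_bits with (q := q); regs; try lia.
    + exists (2 ^ length (pos_bits q)).
      destruct (Nat.eqb_spec (S (rg s 4) + length (pos_bits q)) (rg s 1)); [lia|].
      change (sign_nat (Z.neg q)) with 1. simpl Z.abs_nat. state_eq.
    + exact (holds_tail _ _ _ _ Hh).
    + simpl Nat.pow in Hw; rewrite Nat.pow_add_r in Hw. pose proof (pos_lt_pow2_bits q). simpl in Hw. lia.
    + simpl Nat.pow in Hw; rewrite Nat.pow_add_r in Hw. simpl in Hw. lia.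
Qed.

(** * Marking the images of marked integers *)

(* The integer k is marked in cell |k|: in layer 3 if it is nonnegative and in layer 4 otherwise. *)
Definition layer (k : Z) : nat := if (k <? 0)%Z then 4 else 3.

Definition marked (m : nat -> nat -> bool) (k : Z) : Prop := m (Z.abs_nat k) (layer k) = true.

Definition signed (g v : nat) : Z := if g =? 0 then Z.of_nat v else (- Z.of_nat v)%Z.

(** Truncated subtraction in one order gives the absolute value, and in the other order 0. If the
    first attempt gives 0, the difference is nonpositive and the other order is tried; the integer 0
    goes to layer 3. *)
Definition mark_difference : cmd :=
  Seq (Copy 12 14) (Seq (Loop 13 (Dec 14)) (IfEq 14 0
    (Seq (Copy 13 14) (Seq (Loop 12 (Dec 14)) (IfEq 14 0 (SetB 14 3) (SetB 14 4))))
    (SetB 14 3))).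

Lemma mark_difference_spec s : rg s 0 = 0 ->
  let d := (Z.of_nat (rg s 12) - Z.of_nat (rg s 13))%Z in
  exists t, exec mark_difference s = rset (mset s (Z.abs_nat d) (layer d)) 14 t.
Proof.
  intros H0 d; unfold mark_difference.
  rewrite !exec_Seq, !exec_Copy, exec_sub; regs.
  rewrite exec_IfEq; regs; rewrite H0.
  destruct (Nat.eqb_spec (rg s 12 - rg s 13) 0) as [E|E].
  - rewrite !exec_Seq, !exec_Copy, exec_sub; regs.
    rewrite exec_IfEq; regs; rewrite H0.
    destruct (Nat.eqb_spec (rg s 13 - rg s 12) 0) as [E'|E']; rewrite exec_SetB; regs;
      exists (rg s 13 - rg s 12); replace (rg s 13 - rg s 12) with (Z.abs_nat d) by lia.
    + replace (layer d) with 3 by (unfold layer; destruct (Z.ltb_spec d 0); lia). state_eq.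
    + replace (layer d) with 4 by (unfold layer; destruct (Z.ltb_spec d 0); lia). state_eq.
  - rewrite exec_SetB; regs.
    exists (rg s 12 - rg s 13); replace (rg s 12 - rg s 13) with (Z.abs_nat d) by lia.
    replace (layer d) with 3 by (unfold layer; destruct (Z.ltb_spec d 0); lia). state_eq.
Qed.

(* The image is computed as the difference of the registers 12 and 13; t1 is the one that receives
   the product if the slope is nonnegative. *)
Definition load_image (t1 t2 : nat) : cmd :=
  Seq (Copy 0 12) (Seq (Copy 0 13) (Seq
    (IfEq 9 0 (Loop 8 (Loop 11 (Inc t1))) (Loop 8 (Loop 11 (Inc t2))))
    (IfEq 7 0 (Loop 5 (Inc 12)) (Loop 5 (Inc 13))))).

Definition image (z : Z) (s : state) : Z :=
  (signed (rg s 9) (rg s 8) * z + signed (rg s 7) (rg s 5))%Z.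

Lemma load_image_spec t1 t2 z s : t1 = 12 /\ t2 = 13 /\ z = Z.of_nat (rg s 11) \/
    t1 = 13 /\ t2 = 12 /\ z = (- Z.of_nat (rg s 11))%Z ->
  rg s 0 = 0 ->
  exists x y, exec (load_image t1 t2) s = rset (rset s 12 x) 13 y /\
    (x < rg s 1 -> y < rg s 1 -> (Z.of_nat x - Z.of_nat y)%Z = image z s) /\
    x <= rg s 1 /\ y <= rg s 1 /\
    (rg s 1 <= x \/ rg s 1 <= y -> rg s 1 <= rg s 8 * rg s 11 + rg s 5).
Proof.
  intros Ht H0; unfold load_image, image, signed.
  rewrite !exec_Seq, !exec_Copy, !exec_IfEq; regs; rewrite H0.
  destruct Ht as [(-> & -> & ->)|(-> & -> & ->)]; destruct (Nat.eqb_spec (rg s 9) 0);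
    (rewrite exec_mul by (regs; lia)); regs; rewrite !H0;
    destruct (Nat.eqb_spec (rg s 7) 0); (rewrite exec_add by (regs; lia)); regs;
    (match goal with |- exists x y, ?S = _ /\ _ => exists (rg S 12), (rg S 13) end; regs;
      split; [state_eq|repeat split; lia]).
Qed.

(** An image whose computation has hit the limit may be wrong, so it is dropped. Images of the
    integers on the bounded path stay below the limit and are not lost. *)
Definition mark_image (t1 t2 : nat) : cmd :=
  Seq (load_image t1 t2) (IfEq 12 1 Skip (IfEq 13 1 Skip mark_difference)).

Definition Sound (R : Z -> Prop) (m : nat -> nat -> bool) : Prop :=
  forall p, (m p 3 = true -> R (Z.of_nat p)) /\ (m p 4 = true -> R (- Z.of_nat p)%Z).

(* The last clause says that new marks are only put on integers reachable by F from marked ones. *)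
Definition extends (X : list nat) (F : list (Z * Z)) (s s' : state) : Prop :=
  (forall i, ~ In i X -> rg s' i = rg s i) /\
  (forall p b, b < 3 -> mm s' p b = mm s p b) /\
  (forall p b, mm s p b = true -> mm s' p b = true) /\
  (forall R : Z -> Prop, (forall f k, In f F -> R k -> R (aff_apply f k)) ->
    Sound R (mm s) -> Sound R (mm s')).

Lemma extends_refl X F s : extends X F s s.
Proof. repeat split; auto; apply H0. Qed.

Lemma extends_trans X F s1 s2 s3 : extends X F s1 s2 -> extends X F s2 s3 -> extends X F s1 s3.
Proof.
  intros (A1 & A2 & A3 & A4) (B1 & B2 & B3 & B4); split; [|split; [|split]].
  - intros; rewrite B1, A1; auto.
  - intros; rewrite B2, A2; auto.
  - auto.
  - eauto.
Qed.

Lemma extends_weaken X Y F G s s' : incl X Y -> incl F G -> extends X F s s' -> extends Y G s s'.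
Proof.
  intros HX HF (A1 & A2 & A3 & A4); split; [|split; [|split]]; auto.
Qed.

Lemma extends_regs X F s s' : (forall i, ~ In i X -> rg s' i = rg s i) -> mm s' = mm s ->
  extends X F s s'.
Proof. intros H1 H2; split; [auto|rewrite H2; auto]. Qed.

Lemma Sound_mset R s k : R k -> Sound R (mm s) -> Sound R (mm (mset s (Z.abs_nat k) (layer k))).
Proof.
  intros Hk Hs p; destruct (Hs p) as [H3 H4]; simpl; unfold layer.
  split; intros H; apply orb_prop in H; destruct H as [H|H]; auto;
    apply andb_prop in H; destruct H as [Hp Hl]; apply Nat.eqb_eq in Hp; subst p;
    destruct (Z.ltb_spec k 0); try discriminate.
  - rewrite Zabs2Nat.id_abs, Z.abs_eq; auto.
  - rewrite Zabs2Nat.id_abs, Z.abs_neq, Z.opp_involutive; auto; lia.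
Qed.

Lemma marked_mset s k : marked (mm (mset s (Z.abs_nat k) (layer k))) k.
Proof. unfold marked; simpl. now rewrite !Nat.eqb_refl. Qed.

Lemma layer_ge k : 3 <= layer k < 5.
Proof. unfold layer; destruct (k <? 0)%Z; lia. Qed.

Lemma mark_image_spec t1 t2 z s : t1 = 12 /\ t2 = 13 /\ z = Z.of_nat (rg s 11) \/
    t1 = 13 /\ t2 = 12 /\ z = (- Z.of_nat (rg s 11))%Z ->
  rg s 0 = 0 ->
  let s' := exec (mark_image t1 t2) s in
  (forall i, ~ In i [12; 13; 14] -> rg s' i = rg s i) /\
  (mm s' = mm s /\ rg s 1 <= rg s 8 * rg s 11 + rg s 5 \/
   mm s' = mm (mset s (Z.abs_nat (image z s)) (layer (image z s)))).
Proof.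
  intros Ht H0 s'.
  destruct (load_image_spec t1 t2 z s Ht H0) as (x & y & E & Hval & Hx & Hy & Hov).
  unfold s', mark_image; rewrite exec_Seq, E, !exec_IfEq, exec_Skip; regs.
  assert (Hkeep : forall i, ~ In i [12; 13; 14] -> rg (rset (rset s 12 x) 13 y) i = rg s i).
  { intros i Hi; cbn [rset rg].
    destruct (Nat.eqb_spec i 13), (Nat.eqb_spec i 12); subst; auto; exfalso; apply Hi; simpl; auto. }
  destruct (Nat.eqb_spec x (rg s 1)) as [Ex|Ex]; [split; [exact Hkeep|left; split; [reflexivity|apply Hov; lia]]|].
  destruct (Nat.eqb_spec y (rg s 1)) as [Ey|Ey]; [split; [exact Hkeep|left; split; [reflexivity|apply Hov; lia]]|].
  destruct (mark_difference_spec (rset (rset s 12 x) 13 y)) as (t & Et); [exact H0|].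
  rewrite Et; clear Et; split.
  - intros i Hi; rewrite <- (Hkeep i Hi); cbn [rset mset rg].
    destruct (Nat.eqb_spec i 14); subst; auto; exfalso; apply Hi; simpl; auto.
  - right; rewrite <- Hval by lia. reflexivity.
Qed.

(** Marks placed ahead of the scan are processed in the same pass. This does no harm: they are marks
    of reachable integers, and [covers] speaks only of those present at the start. *)
Definition scan : cmd :=
  Seq (Copy 0 11) (Loop 1 (Seq (IfB 11 3 (mark_image 12 13) Skip)
    (Seq (IfB 11 4 (mark_image 13 12) Skip) (Inc 11)))).

(** The first condition puts the cell of k within the scan, the second rules out truncation at the
    limit. *)
Definition small (L : nat) (f : Z * Z) (k : Z) : Prop :=
  (Z.abs k < Z.of_nat L)%Z /\ (Z.abs (fst f) * Z.abs k + Z.abs (snd f) < Z.of_nat L)%Z.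

Definition covers (f : Z * Z) (s s' : state) : Prop :=
  forall k, marked (mm s) k -> small (rg s 1) f k -> marked (mm s') (aff_apply f k).

Lemma mark_image_extends t1 t2 z b f s :
  t1 = 12 /\ t2 = 13 /\ z = Z.of_nat (rg s 11) /\ b = 3 \/
    t1 = 13 /\ t2 = 12 /\ z = (- Z.of_nat (rg s 11))%Z /\ b = 4 ->
  rg s 0 = 0 -> signed (rg s 9) (rg s 8) = fst f -> signed (rg s 7) (rg s 5) = snd f ->
  let s' := exec (IfB 11 b (mark_image t1 t2) Skip) s in
  extends [12; 13; 14] [f] s s' /\
  (mm s (rg s 11) b = true -> small (rg s 1) f z -> marked (mm s') (aff_apply f z)).
Proof.
  intros Ht H0 Ha Hb s'; unfold s'; rewrite exec_IfB, exec_Skip.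
  destruct (mm s (rg s 11) b) eqn:Eb; [|split; [apply extends_refl|discriminate]].
  assert (Ht' : t1 = 12 /\ t2 = 13 /\ z = Z.of_nat (rg s 11) \/
    t1 = 13 /\ t2 = 12 /\ z = (- Z.of_nat (rg s 11))%Z) by tauto.
  destruct (mark_image_spec t1 t2 z s Ht' H0) as [Hr Hm].
  assert (Hi : image z s = aff_apply f z) by (unfold image, aff_apply; now rewrite Ha, Hb).
  rewrite Hi in Hm.
  assert (Hz : forall R, Sound R (mm s) -> R z).
  { intros R HR; destruct (HR (rg s 11)) as [H3 H4].
    destruct Ht as [(_ & _ & -> & ->)|(_ & _ & -> & ->)]; auto. }
  pose proof (layer_ge (aff_apply f z)) as Hl.
  destruct Hm as [[Hm Hov]|Hm]; split.
  - apply extends_regs; auto.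
  - intros _ [_ Hs]; exfalso. rewrite <- Ha, <- Hb in Hs; unfold signed in Hs.
    destruct (rg s 9 =? 0), (rg s 7 =? 0), Ht as [(_ & _ & -> & _)|(_ & _ & -> & _)]; lia.
  - split; [exact Hr|rewrite Hm; split; [|split]].
    + intros p c Hc; simpl. destruct (Nat.eqb_spec c (layer (aff_apply f z))); [lia|].
      now rewrite andb_false_r.
    + intros p c Hc; simpl. rewrite Hc. apply orb_true_r.
    + intros R HR HS; apply Sound_mset; auto. apply HR; [left; auto|apply Hz; auto].
  - intros _ _. rewrite Hm. apply marked_mset.
Qed.

Lemma scan_spec f s : rg s 0 = 0 ->
  signed (rg s 9) (rg s 8) = fst f -> signed (rg s 7) (rg s 5) = snd f ->
  extends [11; 12; 13; 14] [f] s (exec scan s) /\ covers f s (exec scan s).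
Proof.
  intros H0 Ha Hb; unfold scan; rewrite exec_Seq, exec_Copy, H0.
  set (s0 := rset s 11 0); rewrite exec_Loop.
  assert (E0 : extends [11; 12; 13; 14] [f] s s0).
  { apply extends_regs; [|reflexivity]. intros i Hi; unfold s0; cbn [rset rg].
    destruct (Nat.eqb_spec i 11); [subst; exfalso; apply Hi; simpl; auto|auto]. }
  assert (HL : rg s0 1 = rg s 1) by reflexivity.
  set (P := fun (i : nat) (t : state) => extends [11; 12; 13; 14] [f] s t /\ rg t 11 = i /\
    forall k, (Z.abs k < Z.of_nat i)%Z -> marked (mm s) k -> small (rg s 1) f k ->
      marked (mm t) (aff_apply f k)).
  match goal with |- context [Nat.iter ?n ?g s0] =>
    enough (HP : P n (Nat.iter n g s0)) end.
  { destruct HP as (E1 & _ & E3); split; auto.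
    intros k Hk Hs. apply E3; auto. rewrite HL; apply Hs. }
  apply loop_invariant.
  { split; [exact E0|split; [reflexivity|intros k; lia]]. }
  intros i t Hi (E1 & E2 & E3).
  assert (K : forall j, ~ In j [11; 12; 13; 14] -> rg t j = rg s j) by apply E1.
  rewrite !exec_Seq.
  destruct (mark_image_extends 12 13 (Z.of_nat (rg t 11)) 3 f t) as [F1 F2]; auto 6.
  { rewrite K; auto. simpl; lia. }
  { rewrite !K; auto; simpl; lia. }
  { rewrite !K; auto; simpl; lia. }
  set (t1 := exec (IfB 11 3 (mark_image 12 13) Skip) t) in *.
  assert (K1 : forall j, ~ In j [12; 13; 14] -> rg t1 j = rg t j) by apply F1.
  assert (K1' : forall j, ~ In j [11; 12; 13; 14] -> rg t1 j = rg s j).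
  { intros j Hj; rewrite K1, K; auto. simpl in *; tauto. }
  destruct (mark_image_extends 13 12 (- Z.of_nat (rg t1 11)) 4 f t1) as [G1 G2]; auto 6.
  { rewrite K1'; auto. simpl; lia. }
  { rewrite !K1'; auto; simpl; lia. }
  { rewrite !K1'; auto; simpl; lia. }
  set (t2 := exec (IfB 11 4 (mark_image 13 12) Skip) t1) in *.
  assert (K2 : forall j, ~ In j [12; 13; 14] -> rg t2 j = rg t j).
  { intros j Hj; rewrite (proj1 G1), K1; auto. }
  rewrite exec_Inc, !K2, E2 by (simpl; lia). rewrite (K 1) by (simpl; lia).
  destruct (Nat.eqb_spec i (rg s 1)) as [E|_]; [rewrite HL in Hi; lia|].
  assert (Hinc : incl [12; 13; 14] [11; 12; 13; 14]) by (intros j; simpl; tauto).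
  split; [|split].
  - eapply extends_trans; [exact E1|].
    eapply extends_trans; [eapply extends_weaken; [exact Hinc|apply incl_refl|exact F1]|].
    eapply extends_trans; [eapply extends_weaken; [exact Hinc|apply incl_refl|exact G1]|].
    apply extends_regs; [|reflexivity]. intros j Hj; cbn [rset rg].
    destruct (Nat.eqb_spec j 11); [subst; exfalso; apply Hj; simpl; auto|auto].
  - cbn [rset rg]. now rewrite Nat.eqb_refl.
  - change (mm (rset t2 11 (S i))) with (mm t2). intros k Hk Hm Hs.
    assert (M1 : forall j, marked (mm t) j -> marked (mm t1) j) by (intros j; apply F1).
    assert (M2 : forall j, marked (mm t1) j -> marked (mm t2) j) by (intros j; apply G1).
    assert (Mt : marked (mm t) k) by (apply E1; exact Hm).
    destruct (Z_lt_le_dec (Z.abs k) (Z.of_nat i)); [apply M2, M1, E3; auto|].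
    rewrite E2 in F2. rewrite K1, E2 in G2 by (simpl; lia).
    rewrite (K 1) in F2 by (simpl; lia). rewrite (K1' 1) in G2 by (simpl; lia).
    assert (Hk' : Z.abs_nat k = i) by lia.
    unfold marked, layer in Mt; rewrite Hk' in Mt.
    destruct (Z.ltb_spec k 0).
    + replace k with (- Z.of_nat i)%Z in * by lia. apply G2; auto.
      apply F1; auto.
    + replace k with (Z.of_nat i) in * by lia. apply M2, F2; auto.
Qed.

(** * Saturation *)

Definition enc_function (f : Z * Z) : list nat := enc_Z (fst f) ++ enc_Z (snd f).

Definition if_symbol (c : cmd) : cmd := IfB 4 0 c (IfB 4 1 c (IfB 4 2 c Skip)).

Definition apply_next : cmd :=
  if_symbol (Seq parse (Seq (Copy 5 8) (Seq (Copy 7 9) (Seq parse scan)))).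

Definition work_regs : list nat := [4; 5; 6; 7; 8; 9; 11; 12; 13; 14].

Lemma signed_sign_nat z : signed (sign_nat z) (Z.abs_nat z) = z.
Proof. unfold signed, sign_nat; destruct (Z.ltb_spec z 0); simpl; lia. Qed.

Lemma enc_Z_head z : exists a l, enc_Z z = a :: l /\ 1 <= a <= 4.
Proof.
  destruct z as [|q|q]; simpl; [| |eauto 6 with arith].
  - exists 3, []; split; auto; lia.
  - destruct q; simpl; eexists _, _; split; eauto; lia.
Qed.

Lemma enc_Z_symbols z a : In a (enc_Z z) -> 1 <= a <= 4.
Proof.
  assert (Hbits : forall q b, In b (pos_bits q) -> 1 <= b <= 4).
  { induction q; simpl; intros b Hb; repeat (destruct Hb as [<-|Hb]; [lia|]); auto; destruct Hb. }
  destruct z as [|q|q]; simpl; rewrite ?in_app_iff; simpl; intros Ha;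
    repeat (destruct Ha as [Ha|Ha]); try lia; now apply Hbits in Ha.
Qed.

Lemma enc_input_symbols x y F a : In a (enc_input x y F) -> 1 <= a <= 4.
Proof.
  unfold enc_input; rewrite !in_app_iff, in_flat_map.
  intros [Ha|[Ha|(f & _ & Ha)]]; [| |apply in_app_or in Ha as [Ha|Ha]];
    eapply enc_Z_symbols; eauto.
Qed.

Lemma exec_if_symbol c a l s : holds (mm s) (rg s 4) (a :: l) -> 1 <= a <= 4 ->
  exec (if_symbol c) s = exec c s.
Proof.
  intros Hh Ha; unfold if_symbol; rewrite !exec_IfB, !(holds_head _ _ _ _ _ Hh) by lia.
  assert (a = 1 \/ a = 2 \/ a = 3 \/ a = 4) as [-> | [-> | [-> | ->]]] by lia; reflexivity.
Qed.

Lemma exec_if_blank c s : holds (mm s) (rg s 4) [0] -> exec (if_symbol c) s = s.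
Proof.
  intros Hh; unfold if_symbol; rewrite !exec_IfB, !(holds_head _ _ _ _ _ Hh) by lia. reflexivity.
Qed.

Lemma holds_extends X F s s' p l : extends X F s s' -> holds (mm s) p l -> holds (mm s') p l.
Proof. intros (_ & H & _) Hh i b Hi Hb. rewrite H; auto. Qed.

Ltac frame := let i := fresh "i" in let Hi := fresh "Hi" in intros i Hi; cbn [rset rg]; unfold work_regs in Hi; repeat
  match goal with |- context [i =? ?r] =>
    destruct (Nat.eqb_spec i r); [subst i; exfalso; apply Hi; simpl; tauto|]
  end; auto.

Lemma apply_next_spec f l s : rg s 0 = 0 -> holds (mm s) (rg s 4) (enc_function f ++ l) ->
  rg s 4 + length (enc_function f) <= rg s 1 -> 2 ^ length (enc_function f) <= rg s 1 ->
  let s' := exec apply_next s in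
  extends work_regs [f] s s' /\ covers f s s' /\ rg s' 4 = rg s 4 + length (enc_function f).
Proof.
  intros H0 Hh Hp Hw s'; unfold s', apply_next, enc_function in *.
  rewrite <- app_assoc in Hh; rewrite length_app in *.
  destruct (enc_Z_head (fst f)) as (a & l' & Ea & Ha).
  rewrite (exec_if_symbol _ a (l' ++ enc_Z (snd f) ++ l)); auto.
  2:{ rewrite Ea in Hh; exact Hh. }
  apply holds_app in Hh as [Hh1 Hh2]; apply holds_app in Hh2 as [Hh2 _].
  rewrite Nat.pow_add_r in Hw.
  pose proof (Nat.pow_nonzero 2 (length (enc_Z (fst f))) ltac:(lia)).
  pose proof (Nat.pow_nonzero 2 (length (enc_Z (snd f))) ltac:(lia)).
  destruct (parse_spec (fst f) s H0 Hh1 ltac:(lia) ltac:(nia)) as (w1 & E1).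
  rewrite !exec_Seq, E1, !exec_Copy.
  match goal with |- context [exec parse ?t] => set (s1 := t) end.
  destruct (parse_spec (snd f) s1) as (w2 & E2); try exact H0.
  { exact Hh2. }
  { unfold s1; regs. lia. }
  { unfold s1; regs. nia. }
  rewrite E2.
  match goal with |- context [exec scan ?t] => set (s2 := t) end.
  assert (X2 : extends work_regs [f] s s2).
  { apply extends_regs; [|reflexivity]. unfold s2, s1. frame. }
  destruct (scan_spec f s2) as [S1 S2]; try exact H0.
  { apply signed_sign_nat. }
  { apply signed_sign_nat. }
  split; [|split].
  - eapply extends_trans; [exact X2|eapply extends_weaken; [|apply incl_refl|exact S1]].
    unfold work_regs; intros i; simpl; tauto.
  - exact S2.
  - rewrite (proj1 S1) by (simpl; lia). unfold s2, s1; regs. lia.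
Qed.

Lemma marked_extends X F s s' k : extends X F s s' -> marked (mm s) k -> marked (mm s') k.
Proof. intros (_ & _ & H & _); apply H. Qed.

(** The program does not know the number of functions. The trailing 0 is the blank behind the input,
    where [apply_next] becomes idle, so any sufficient number of rounds will do. *)
Lemma apply_all F : forall n s, length F <= n -> rg s 0 = 0 ->
  holds (mm s) (rg s 4) (flat_map enc_function F ++ [0]) ->
  rg s 4 + length (flat_map enc_function F) <= rg s 1 ->
  2 ^ length (flat_map enc_function F) <= rg s 1 ->
  let s' := Nat.iter n (exec apply_next) s in
  extends work_regs F s s' /\ forall f, In f F -> covers f s s'.
Proof.
  induction F as [|f F IH]; intros n s Hn H0 Hh Hp Hw s'; unfold s'; clear s'.
  - assert (E : Nat.iter n (exec apply_next) s = s).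
    { clear Hn. induction n as [|n IHn]; auto. rewrite Nat.iter_succ, IHn. apply exec_if_blank; auto. }
    rewrite E; split; [apply extends_refl|intros ? []].
  - destruct n as [|n]; simpl in Hn; [lia|]. cbn [flat_map] in *.
    rewrite <- app_assoc in Hh; rewrite length_app, ?Nat.pow_add_r in *.
    pose proof (Nat.pow_nonzero 2 (length (enc_function f)) ltac:(lia)).
    pose proof (Nat.pow_nonzero 2 (length (flat_map enc_function F)) ltac:(lia)).
    rewrite Nat.iter_succ_r.
    destruct (apply_next_spec f _ s H0 Hh ltac:(lia) ltac:(nia)) as (X1 & C1 & P1).
    set (s1 := exec apply_next s) in *.
    apply holds_app in Hh as [_ Hh].
    assert (K : forall i, ~ In i work_regs -> rg s1 i = rg s i) by apply X1.
    destruct (IH n s1) as (X2 & C2).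
    + lia.
    + rewrite K; auto. unfold work_regs; simpl; lia.
    + rewrite P1. eapply holds_extends; eauto.
    + rewrite P1, K by (unfold work_regs; simpl; lia). lia.
    + rewrite K by (unfold work_regs; simpl; lia). nia.
    + split.
      * eapply extends_trans; eapply extends_weaken; [apply incl_refl| |exact X1|apply incl_refl| |exact X2];
          intros g; simpl; tauto.
      * intros g [<-|Hg] k Hk Hs.
        { eapply marked_extends; [exact X2|]. apply C1; auto. }
        { apply C2; auto.
          - eapply marked_extends; eauto.
          - rewrite K by (unfold work_regs; simpl; lia). auto. }
Qed.

Definition saturate : cmd := Loop 1 (Seq (Copy 10 4) (Loop 1 apply_next)).

Lemma along_snoc {A L : Type} (T : A -> L -> A) (P : A -> Prop) f : forall l a,
  along T P a (l ++ [f]) -> along T P a l /\ P (fold_left T l a).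
Proof.
  induction l as [|s l IH]; intros a [Ha Hl]; simpl in *.
  - auto.
  - apply IH in Hl as [H1 H2]. auto.
Qed.

(** Invariant: after i rounds the ends of all paths in [-B, B] with at most i letters are marked. A
    path of i + 1 letters is split before its last letter, which the next round applies. *)
Lemma saturate_spec F B s : rg s 0 = 0 ->
  holds (mm s) (rg s 10) (flat_map enc_function F ++ [0]) ->
  rg s 10 + length (flat_map enc_function F) <= rg s 1 ->
  2 ^ length (flat_map enc_function F) <= rg s 1 -> length F <= rg s 1 ->
  (forall f k, In f F -> (Z.abs k <= B)%Z -> small (rg s 1) f k) ->
  let s' := exec saturate s in
  extends work_regs F s s' /\
  forall l k, length l <= rg s 1 -> incl l F -> along apply_to (fun c => (Z.abs c <= B)%Z) k l ->
    marked (mm s) k -> marked (mm s') (compose_apply l k).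
Proof.
  intros H0 Hh Hp Hw Hlen Hsmall s'; unfold s', saturate; rewrite exec_Loop; clear s'.
  set (P := fun i t => extends work_regs F s t /\
    forall l k, length l <= i -> incl l F -> along apply_to (fun c => (Z.abs c <= B)%Z) k l ->
    marked (mm s) k -> marked (mm t) (compose_apply l k)).
  apply (loop_invariant P).
  - split; [apply extends_refl|]. intros l k Hl. destruct l; [auto|simpl in Hl; lia].
  - intros i t Hi [X C]. rewrite exec_Seq, exec_Copy, exec_Loop.
    set (t0 := rset t 4 (rg t 10)).
    assert (K : forall i, ~ In i work_regs -> rg t i = rg s i) by apply X.
    assert (X0 : extends work_regs F s t0).
    { eapply extends_trans; [exact X|]. apply extends_regs; [|reflexivity]. unfold t0; frame. }
    assert (K10 : rg t 10 = rg s 10) by (apply K; unfold work_regs; simpl; lia).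
    assert (K1 : rg t 1 = rg s 1) by (apply K; unfold work_regs; simpl; lia).
    assert (K0 : rg t 0 = rg s 0) by (apply K; unfold work_regs; simpl; lia).
    destruct (apply_all F (rg t0 1) t0) as [X1 C1]; unfold t0; regs; rewrite ?K10, ?K1, ?K0; auto.
    { eapply holds_extends; eauto. }
    fold t0; rewrite <- K10; fold t0.
    assert (Et : rg t0 1 = rg s 1) by exact K1.
    rewrite <- Et. unfold t0 in Et.
    split; [eapply extends_trans; eauto|].
    intros l k Hl Hin Hal Hk.
    destruct (Nat.eq_dec (length l) (S i)) as [E|E].
    + destruct (exists_last (l := l)) as (l1 & f & ->); [intros ->; discriminate|].
      apply along_snoc in Hal as [Hal Hb]. rewrite length_app in E; simpl in E.
      rewrite compose_app. change (compose_apply [f] (compose_apply l1 k)) with (aff_apply f (compose_apply l1 k)).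
      assert (Hf : In f F) by (apply Hin, in_or_app; right; left; auto).
      apply C1; auto.
      * apply C; auto; [lia|]. intros g Hg; apply Hin, in_or_app; auto.
      * change (rg t0 1) with (rg t 1). rewrite K1. apply Hsmall; auto.
    + eapply marked_extends; [exact X1|]. apply C; auto; lia.
Qed.

(** * Making room *)

(** The limit is raised before each increment, so the increment is never blocked; the number of
    rounds is fixed by the initial value of [r]. *)
Definition double (r : nat) : cmd := Loop r (Seq Extend (Inc r)).

Lemma double_spec r s : 2 <= r -> rg s r <= rg s 1 ->
  exec (double r) s = rset (rset s 1 (rg s 1 + rg s r)) r (2 * rg s r).
Proof.
  intros Hr Hle; unfold double; rewrite exec_Loop.
  assert (H : forall n, Nat.iter n (exec (Seq Extend (Inc r))) s =
    rset (rset s 1 (rg s 1 + n)) r (rg s r + n)).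
  { induction n as [|n IH]; [simpl; state_eq|].
    rewrite Nat.iter_succ, IH, exec_Seq, exec_Inc. cbn [exec rset rg].
    destruct (Nat.eqb_spec r 1); [lia|]. destruct (Nat.eqb_spec 1 r); [lia|].
    rewrite !Nat.eqb_refl.
    destruct (Nat.eqb_spec (rg s r + n) (S (rg s 1 + n))); [lia|]. state_eq. }
  rewrite H. f_equal. lia.
Qed.

Lemma double_iter r n s : 2 <= r -> rg s r <= rg s 1 ->
  Nat.iter n (exec (double r)) s =
  rset (rset s 1 (rg s 1 + rg s r * 2 ^ n - rg s r)) r (rg s r * 2 ^ n).
Proof.
  intros Hr Hle; induction n as [|n IH]; [simpl; state_eq|].
  pose proof (Nat.pow_nonzero 2 n ltac:(lia)).
  rewrite Nat.iter_succ, IH, double_spec; auto; cbn [rset rg]; rewrite !Nat.eqb_refl;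
    destruct (Nat.eqb_spec 1 r); try lia; rewrite ?Nat.eqb_refl.
  rewrite Nat.pow_succ_r'. assert (rg s r <= rg s r * 2 ^ n) by nia. state_eq.
Qed.

(** With input length n in register 16, register 2 grows from 1 to 2^(10 n), and then register 3
    from 1 to 2^(2^(10 n)). Each doubling raises the limit by as much as it adds to the register,
    which gives the three parts of [room n]. *)
Definition make_room : cmd :=
  Seq (Copy 1 16) (Seq (Inc 2) (Seq (Nat.iter 10 (Seq (Loop 16 (double 2))) Skip)
    (Seq (Inc 3) (Loop 2 (double 3))))).

Definition room (n : nat) : nat := n + 2 ^ (10 * n) - 1 + 2 ^ 2 ^ (10 * n) - 1.

Lemma pow_iter j s : rg s 2 <= rg s 1 ->
  exec (Nat.iter j (Seq (Loop 16 (double 2))) Skip) s =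
  rset (rset s 1 (rg s 1 + rg s 2 * 2 ^ (j * rg s 16) - rg s 2)) 2 (rg s 2 * 2 ^ (j * rg s 16)).
Proof.
  revert s; induction j as [|j IH]; intros s Hle; [simpl; state_eq|].
  rewrite Nat.iter_succ, exec_Seq, exec_Loop, double_iter by lia.
  pose proof (Nat.pow_nonzero 2 (rg s 16) ltac:(lia)).
  pose proof (Nat.pow_nonzero 2 (j * rg s 16) ltac:(lia)).
  assert (rg s 2 <= rg s 2 * 2 ^ rg s 16) by nia.
  rewrite IH; regs; [|lia].
  replace (S j * rg s 16) with (rg s 16 + j * rg s 16) by lia. rewrite Nat.pow_add_r, Nat.mul_assoc.
  assert (rg s 2 * 2 ^ rg s 16 <= rg s 2 * 2 ^ rg s 16 * 2 ^ (j * rg s 16)) by nia.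
  state_eq.
Qed.

Lemma make_room_spec s n : 0 < n -> rg s 1 = n -> (forall i, i <> 1 -> rg s i = 0) ->
  let s' := exec make_room s in
  rg s' 1 = room n /\ rg s' 0 = 0 /\ rg s' 15 = 0 /\ mm s' = mm s.
Proof.
  intros Hn H1 H0 s'; unfold s', make_room; clear s'.
  assert (E : exec (Inc 2) (exec (Copy 1 16) s) = rset (rset s 16 n) 2 1).
  { rewrite exec_Copy, exec_Inc; regs. rewrite (H0 2), H1 by lia.
    destruct (Nat.eqb_spec 0 n); [lia|reflexivity]. }
  rewrite !exec_Seq, E, pow_iter by (regs; lia). regs. rewrite H1, !Nat.mul_1_l.
  pose proof (Nat.pow_nonzero 2 (10 * n) ltac:(lia)).
  pose proof (Nat.pow_nonzero 2 (2 ^ (10 * n)) ltac:(lia)).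
  rewrite exec_Inc; cbn [rset rg]; simpl (3 =? _); simpl (1 =? _); cbn iota. rewrite (H0 3) by lia.
  destruct (Nat.eqb_spec 0 (n + 2 ^ (10 * n) - 1)); [lia|].
  rewrite exec_Loop, double_iter; cbn [rset rg mm]; simpl (_ =? 3); cbn iota; try lia;
    simpl (_ =? 2); simpl (_ =? 1); simpl (_ =? 16); cbn iota; try lia.
  unfold room. rewrite !Nat.mul_1_l. repeat split; auto; lia.
Qed.

(** * Assembling the decision procedure *)

Definition mark_value : cmd := IfEq 7 0 (SetB 5 3) (SetB 5 4).

Definition test_value : cmd := IfEq 7 0 (IfB 5 3 (Inc 15) Skip) (IfB 5 4 (Inc 15) Skip).

(** The first reading of [y] only locates the list of functions. Saturation overwrites the working
    registers, so both integers are read again before the test. *)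
Definition decide_reach : cmd :=
  Seq (Copy 0 4) (Seq parse (Seq mark_value (Seq parse (Seq (Copy 4 10)
    (Seq saturate (Seq (Copy 0 4) (Seq parse (Seq parse test_value)))))))).

Lemma mark_value_spec x s : rg s 0 = 0 -> rg s 5 = Z.abs_nat x -> rg s 7 = sign_nat x ->
  exec mark_value s = mset s (Z.abs_nat x) (layer x).
Proof.
  intros H0 H5 H7; unfold mark_value; rewrite exec_IfEq, H0, H7, !exec_SetB, H5.
  unfold sign_nat, layer; destruct (x <? 0)%Z; reflexivity.
Qed.

Lemma test_value_spec y s : rg s 0 = 0 -> rg s 5 = Z.abs_nat y -> rg s 7 = sign_nat y ->
  rg s 15 = 0 -> 0 < rg s 1 ->
  let s' := exec test_value s in
  rg s' 1 = rg s 1 /\ (rg s' 15 <> 0 <-> marked (mm s) y).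
Proof.
  intros H0 H5 H7 H15 H1 s'; unfold s', test_value, marked.
  rewrite exec_IfEq, H0, H7, !exec_IfB, !exec_Skip, !exec_Inc, H5, H15.
  destruct (Nat.eqb_spec 0 (rg s 1)); [lia|].
  unfold sign_nat, layer; destruct (y <? 0)%Z; simpl (_ =? 0); cbn iota;
    destruct (mm s (Z.abs_nat y) _); cbn [rset rg]; regs;
    split; auto; split; auto; try discriminate; rewrite H15; congruence.
Qed.

Lemma holds_mset s q k p l : holds (mm s) p l -> holds (mm (mset s q (layer k))) p l.
Proof.
  intros Hh i b Hi Hb; simpl. pose proof (layer_ge k).
  destruct (Nat.eqb_spec b (layer k)); [lia|]. rewrite andb_false_r; simpl; auto.
Qed.

Lemma decide_reach_spec x y F B L s1 : let input := enc_input x y F in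
  2 ^ length input <= L -> length input <= L ->
  (forall f k, In f F -> (Z.abs k <= B)%Z -> small L f k) ->
  (reach F x y -> breach F B x y) -> (2 * B + 1 <= Z.of_nat L)%Z ->
  rg s1 1 = L -> rg s1 0 = 0 -> rg s1 15 = 0 -> mm s1 = mm (init_state input) ->
  let s' := exec decide_reach s1 in
  rg s' 1 = L /\ (rg s' 15 <> 0 <-> reach F x y).
Proof.
  intros input Hpow HlenL Hsmall Hbounded HB H1 H0 H15 Hm s'; unfold s', decide_reach; clear s'.
  assert (Hx1 : 0 < length (enc_Z x)) by (destruct (enc_Z_head x) as (a & l & -> & _); simpl; lia).
  assert (Hlen : length input = length (enc_Z x) + length (enc_Z y) + length (flat_map enc_function F)).
  { unfold input, enc_input; rewrite !length_app, Nat.add_assoc; reflexivity. }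
  assert (Hh : holds (mm s1) 0 (enc_Z x ++ enc_Z y ++ flat_map enc_function F ++ [0])).
  { rewrite !app_assoc, <- (app_assoc (enc_Z x)), Hm. fold (enc_input x y F).
    change (enc_Z x ++ enc_Z y ++ flat_map enc_function F) with input.
    intros i b Hi Hb; simpl. rewrite length_app in Hi; simpl in Hi.
    destruct (Nat.lt_ge_cases i (length input)).
    - rewrite app_nth1; auto.
    - replace i with (length input) by lia. rewrite nth_middle, nth_overflow; auto. }
  apply holds_app in Hh as [Hhx Hh]; apply holds_app in Hh as [Hhy HhF].
  assert (Hp2 : forall k, k <= length input -> 2 ^ k <= L).
  { intros k Hk; eapply Nat.le_trans; [apply Nat.pow_le_mono_r; [lia|exact Hk]|exact Hpow]. }
  rewrite exec_Seq, exec_Copy, H0; set (s2 := rset s1 4 0).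
  destruct (parse_spec x s2) as (w1 & E1); [exact H0|exact Hhx| | |].
  { unfold s2; regs. rewrite H1; lia. }
  { unfold s2; regs. rewrite H1; apply Hp2; lia. }
  rewrite exec_Seq, E1; clear E1.
  match goal with |- context [exec _ ?t] => set (s3 := t) end.
  rewrite exec_Seq, (mark_value_spec x) by (unfold s3; regs; auto).
  set (s4 := mset s3 (Z.abs_nat x) (layer x)).
  destruct (parse_spec y s4) as (w2 & E2); [exact H0|apply holds_mset; exact Hhy| | |].
  { unfold s4, s3, s2; regs. rewrite H1; lia. }
  { unfold s4, s3, s2; regs. rewrite H1; apply Hp2; lia. }
  rewrite exec_Seq, E2; clear E2.
  rewrite exec_Seq, exec_Copy.
  match goal with |- context [exec _ ?t] => set (s6 := t) end.
  assert (R10 : rg s6 10 = length (enc_Z x) + length (enc_Z y)) by (unfold s6, s4, s3, s2; regs; lia).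
  assert (R1 : rg s6 1 = L) by exact H1.
  destruct (saturate_spec F B s6) as [X C].
  { exact H0. }
  { rewrite R10. apply holds_mset; exact HhF. }
  { rewrite R10, R1; lia. }
  { rewrite R1; apply Hp2; lia. }
  { rewrite R1. enough (length F <= length (flat_map enc_function F)) by lia.
    clear; induction F as [|f F IH]; simpl; [auto|]. rewrite length_app.
    unfold enc_function at 1. rewrite length_app.
    destruct (enc_Z_head (fst f)) as (a & l & -> & _); simpl; lia. }
  { rewrite R1; exact Hsmall. }
  rewrite exec_Seq; revert X C; generalize (exec saturate s6); intros s7 X C.
  assert (K : forall i, ~ In i work_regs -> rg s7 i = rg s6 i) by apply X.
  assert (Hm6 : forall l p, holds (mm s1) p l -> holds (mm s7) p l).
  { intros l p Hl; eapply holds_extends; [exact X|]. apply holds_mset; exact Hl. }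
  assert (K0 : rg s7 0 = 0) by (rewrite K by (unfold work_regs; simpl; lia); exact H0).
  assert (K1 : rg s7 1 = L) by (rewrite K by (unfold work_regs; simpl; lia); exact H1).
  assert (K15 : rg s7 15 = 0) by (rewrite K by (unfold work_regs; simpl; lia); exact H15).
  rewrite exec_Seq, exec_Copy, K0; set (s8 := rset s7 4 0).
  destruct (parse_spec x s8) as (w3 & E3); [exact K0|apply Hm6; exact Hhx| | |].
  { unfold s8; regs. rewrite K1; lia. }
  { unfold s8; regs. rewrite K1; apply Hp2; lia. }
  rewrite exec_Seq, E3; clear E3.
  match goal with |- context [exec _ ?t] => set (s9 := t) end.
  destruct (parse_spec y s9) as (w4 & E4); [exact K0|apply Hm6; exact Hhy| | |].
  { unfold s9, s8; regs. rewrite K1; lia. }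
  { unfold s9, s8; regs. rewrite K1; apply Hp2; lia. }
  rewrite exec_Seq, E4; clear E4.
  match goal with |- context [exec test_value ?t] => set (s10 := t) end.
  destruct (test_value_spec y s10) as [T1 T2]; [exact K0|reflexivity|reflexivity|exact K15| |].
  { unfold s10, s9, s8; regs. rewrite K1; lia. }
  change (mm s10) with (mm s7) in T2.
  rewrite T1, T2; split; [exact K1|split].
  - intros Hy.
    set (R := fun k => reach F x k).
    assert (HS : Sound R (mm s7)).
    { apply X.
      - intros f k Hf (l & Hl & Hk). exists (l ++ [f]); split.
        + intros g Hg; apply in_app_or in Hg as [Hg|[<-|[]]]; auto.
        + rewrite compose_app, Hk; reflexivity.
      - change (mm s6) with (mm s4). apply Sound_mset.
        + exists []; split; [intros ? []|reflexivity].
        + change (mm s3) with (mm s1). rewrite Hm.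
          (* Input symbols are at most 4, so the bitmap layers are empty before [x] is marked. *)
          assert (Hno : forall p b, 3 <= b -> mm (init_state input) p b = false).
          { intros p b Hb; simpl. apply testbit_symbol; auto.
            destruct (nth_in_or_default p input 0) as [Hin| ->]; [|lia].
            exact (proj2 (enc_input_symbols x y F _ Hin)). }
          intros p; rewrite !Hno by lia; split; discriminate. }
    unfold marked, layer in Hy; destruct (HS (Z.abs_nat y)) as [HS3 HS4].
    destruct (Z.ltb_spec y 0).
    + specialize (HS4 Hy). replace (- Z.of_nat (Z.abs_nat y))%Z with y in HS4 by lia. exact HS4.
    + specialize (HS3 Hy). replace (Z.of_nat (Z.abs_nat y)) with y in HS3 by lia. exact HS3.
  - intros Hr; destruct (breach_short F B x y (Hbounded Hr)) as (l & Hl & Hll & <- & Hal).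
    apply C; auto.
    + rewrite R1; lia.
    + change (mm s6) with (mm s4). apply marked_mset.
Qed.

Definition decider : cmd := Seq make_room decide_reach.

(** * Bounds *)

Lemma abs_lt_pow2_enc z : (Z.abs z <= 2 ^ Z.of_nat (length (enc_Z z)))%Z.
Proof.
  assert (H : forall q k, length (pos_bits q) <= k -> (Z.pos q <= 2 ^ Z.of_nat k)%Z).
  { intros q k Hk; pose proof (pos_lt_pow2_bits q) as Hq.
    pose proof (Nat.pow_le_mono_r 2 _ _ ltac:(lia) Hk) as Hp.
    change 2%Z with (Z.of_nat 2); rewrite <- Nat2Z.inj_pow. lia. }
  destruct z as [|q|q]; [apply Z.pow_nonneg; lia| |];
    apply H; simpl; rewrite length_app; simpl; lia.
Qed.

(** The left side is what [small] requires of all |k| <= [value_bound M]. Since M + 1 <= 2^(n + 1),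
    its logarithm is at most (n + 1) e + n + 2 with e = M^2 + 2M + 4, and this is below M^4 <= 2^(10
    n). *)
Lemma value_bound_room n : 2 <= n -> let M := (2 ^ Z.of_nat n)%Z in
  (M * value_bound M + M + 2 <= Z.of_nat (room n))%Z.
Proof.
  intros Hn M.
  assert (HM4 : (4 <= M)%Z) by (change 4%Z with (2 ^ 2)%Z; apply Z.pow_le_mono_r; lia).
  assert (HnM : (Z.of_nat n + 2 <= M)%Z).
  { unfold M; clear M HM4. induction n as [|n IH]; [lia|].
    destruct (Nat.eq_dec n 1) as [->|]; [reflexivity|].
    rewrite Nat2Z.inj_succ, Z.pow_succ_r by lia. specialize (IH ltac:(lia)). lia. }
  set (e := (M * M + 2 * M + 4)%Z).
  assert (He : (0 <= e)%Z) by nia.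
  assert (Hvb : (value_bound M <= 2 ^ ((Z.of_nat n + 1) * e))%Z).
  { rewrite Z.pow_mul_r by lia. apply Z.pow_le_mono_l. split; [lia|].
    rewrite Z.pow_add_r by lia. fold M. lia. }
  assert (Hvb0 : (1 <= value_bound M)%Z).
  { unfold value_bound. pose proof (Z.pow_pos_nonneg (M + 1) e ltac:(lia) He). unfold e in *. lia. }
  assert (HE : ((Z.of_nat n + 1) * e + (Z.of_nat n + 2) <= 2 ^ (10 * Z.of_nat n))%Z).
  { replace (10 * Z.of_nat n)%Z with (Z.of_nat n * 10)%Z by lia. rewrite Z.pow_mul_r by lia. fold M.
    apply Z.le_trans with (m := (M ^ 4)%Z); [|apply Z.pow_le_mono_r; lia].
    apply Z.le_trans with (m := (M * e + M)%Z); [nia|]. unfold e.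
    replace (M ^ 4)%Z with (M * M * (M * M))%Z by ring. nia. }
  assert (Hpow : (M * value_bound M + M + 2 <= 2 ^ (2 ^ (10 * Z.of_nat n)))%Z).
  { apply Z.le_trans with (m := (2 ^ ((Z.of_nat n + 1) * e + (Z.of_nat n + 2)))%Z);
      [|apply Z.pow_le_mono_r; lia].
    rewrite Z.pow_add_r, (Z.pow_add_r _ (Z.of_nat n)) by nia. fold M. change (2 ^ 2)%Z with 4%Z.
    set (V := value_bound M) in *. set (W := (2 ^ ((Z.of_nat n + 1) * e))%Z) in *. nia. }
  assert (Hroom : Z.of_nat (2 ^ 2 ^ (10 * n)) = (2 ^ (2 ^ (10 * Z.of_nat n)))%Z).
  { rewrite !Nat2Z.inj_pow, Nat2Z.inj_mul. reflexivity. }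
  rewrite <- Hroom in Hpow.
  assert (2 ^ 2 ^ (10 * n) <= room n).
  { unfold room. pose proof (Nat.pow_nonzero 2 (10 * n) ltac:(lia)). lia. }
  lia.
Qed.

(** With E = 2^(10 n), the limit plus one is at most 2^(E + 2), and C <= 2^C. The exponent C + (E +
    2) k is at most E (C + 3k) <= 2^(10 n + C + 3k), which is where [c] comes from. *)
Lemma time_bound C k n : 0 < n -> let c := 10 + C + 3 * k in
  C * (room n + 1) ^ k <= 2 ^ 2 ^ (c * (n + 1) ^ c).
Proof.
  intros Hn c.
  assert (Hlin : forall a, a <= 2 ^ a) by (intros a; apply Nat.lt_le_incl, Nat.pow_gt_lin_r; lia).
  set (E := 2 ^ (10 * n)).
  assert (HE : 1 <= E) by (pose proof (Nat.pow_nonzero 2 (10 * n) ltac:(lia)); unfold E; lia).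
  assert (Hr : room n + 1 <= 2 ^ (E + 2)).
  { unfold room; fold E. rewrite Nat.pow_add_r. change (2 ^ 2) with 4.
    pose proof (Hlin E). assert (n <= E) by (unfold E; pose proof (Hlin (10 * n)); lia). lia. }
  apply Nat.le_trans with (2 ^ C * (2 ^ (E + 2)) ^ k).
  { apply Nat.mul_le_mono; [apply Hlin|apply Nat.pow_le_mono_l; exact Hr]. }
  rewrite <- Nat.pow_mul_r, <- Nat.pow_add_r.
  apply Nat.pow_le_mono_r; [lia|].
  apply Nat.le_trans with (2 ^ (10 * n) * 2 ^ (C + 3 * k)).
  { fold E. apply Nat.le_trans with (E * (C + 3 * k)); [nia|].
    apply Nat.mul_le_mono_l, Hlin. }
  rewrite <- Nat.pow_add_r. apply Nat.pow_le_mono_r; [lia|].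
  apply Nat.le_trans with (c * (n + 1) ^ 1).
  - rewrite Nat.pow_1_r. unfold c. nia.
  - apply Nat.mul_le_mono_l, Nat.pow_le_mono_r; unfold c; lia.
Qed.

Theorem mainTheorem8 :
  exists M : TM, TM_wf M /\
  exists c : nat,
    forall (x y : Z) (F : list (Z * Z)),
      let n := length (enc_input x y F) in
      exists t : nat,
        (t <= 2 ^ (2 ^ (c * (n + 1) ^ c)))%nat /\
        halted M (run M t (enc_input x y F)) /\
        (cst (run M t (enc_input x y F)) = qacc M <-> reach F x y).
Proof.
  (* The program uses registers 0 to 16 and leaves its answer in register 15; its well-formedness is
     checked by computation. *)
  destruct (loop_machine 17 decider 15) as (M & Hwf & C & k & HM); [lia|lia|reflexivity|].
  exists M; split; [exact Hwf|]. exists (10 + C + 3 * k). intros x y F n.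
  assert (Hlen : n = length (enc_Z x) + length (enc_Z y) + length (flat_map enc_function F)).
  { unfold n, enc_input; rewrite !length_app, Nat.add_assoc; reflexivity. }
  destruct (enc_Z_head x) as (ax & lx & Ex & _); destruct (enc_Z_head y) as (ay & ly & Ey & _).
  assert (Hn : 2 <= n) by (rewrite Hlen, Ex, Ey; simpl; lia).
  destruct (HM (enc_input x y F)) as (t & Ht & Hhalt & Hacc).
  { unfold enc_input; rewrite Ex; discriminate. }
  { apply enc_input_symbols. }
  pose proof (value_bound_room n Hn) as HB; cbv zeta in HB.
  set (V := (2 ^ Z.of_nat n)%Z) in *.
  assert (HV4 : (4 <= V)%Z) by (change 4%Z with (2 ^ 2)%Z; apply Z.pow_le_mono_r; lia).
  assert (HVB : (V <= value_bound V)%Z).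
  { pose proof (no_translation_le_value_bound V ltac:(lia)). nia. }
  assert (Habs : forall z, length (enc_Z z) <= n -> (Z.abs z <= V)%Z).
  { intros z Hz; eapply Z.le_trans; [apply abs_lt_pow2_enc|]. apply Z.pow_le_mono_r; lia. }
  assert (HF : bounded_coeffs V F).
  { intros f Hf.
    assert (length (enc_function f) <= length (flat_map enc_function F)).
    { clear - Hf; induction F as [|g F IH]; [destruct Hf|]. simpl; rewrite length_app.
      destruct Hf as [->|Hf]; [lia|specialize (IH Hf); lia]. }
    unfold enc_function at 1 in H; rewrite length_app in H. split; apply Habs; lia. }
  destruct (make_room_spec (init_state (enc_input x y F)) n) as (R1 & R0 & R15 & Rm).
  { lia. }
  { reflexivity. }
  { intros i Hi; simpl. destruct (Nat.eqb_spec i 1); [lia|auto]. }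
  unfold decider in Ht, Hacc; rewrite exec_Seq in Ht, Hacc.
  revert Ht Hacc R1 R0 R15 Rm; generalize (exec make_room (init_state (enc_input x y F))).
  intros s1 Ht Hacc R1 R0 R15 Rm.
  destruct (decide_reach_spec x y F (value_bound V) (room n) s1) as [S1 S2]; auto; fold n.
  - apply Nat2Z.inj_le. rewrite Nat2Z.inj_pow. change (Z.of_nat 2) with 2%Z. fold V.
    assert (V <= V * value_bound V)%Z by nia. lia.
  - apply Nat2Z.inj_le. pose proof (Z.pow_gt_lin_r 2 (Z.of_nat n) ltac:(lia) ltac:(lia)) as Hlin.
    fold V in Hlin. assert (V <= V * value_bound V)%Z by nia. lia.
  - intros f j Hf Hj; destruct (HF f Hf). split; nia.
  - apply reach_bounded; auto; try lia; apply Habs; lia.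
  - nia.
  - exists t; split; [|split; [exact Hhalt|rewrite Hacc; exact S2]].
    eapply Nat.le_trans; [exact Ht|]. rewrite S1. apply time_bound. lia.
Qed.
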